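(* Let $\mathfrak{H}$ and $\mathfrak{K}_n$, $n\in\mathbb{N}$, be Hilbert spaces and let $T_n\in\mathbf{L}(\mathfrak{H},\mathfrak{K}_n)$ be a sequence of closed linear operators which satisfy $T_n\prec_cT_m$ for $m\le n$. Let $T\in\mathbf{L}(\mathfrak{H},\mathfrak{K})$, where $\mathfrak{K}$ is a Hilbert space, be the limit operator, i.e. a linear operator with $$\operatorname{dom}T=\bigcup_{n\in\mathbb{N}}\operatorname{dom}T_n,\qquad T\prec_cT_n\ (n\in\mathbb{N}),\qquad\|T_n\varphi\|\searrow\|T\varphi\|,\ \ \varphi\in\operatorname{dom}T.$$ Let $K_\infty\in\mathbf{L}(\mathfrak{H})$ be the nonnegative selfadjoint relation which is the limit (in the strong resolvent sense or, equivalently, in the strong graph sense) of the nonincreasing sequence of nonnegative selfadjoint relations $K_n=T_n^*T_n\in\mathbf{L}(\mathfrak{H})$. Then $K_\infty$ and $T$ are connected via $$K_\infty=T^*T^{**}.$$ Consequently, there exists a partial isometry $U\in\mathbf{B}(\mathfrak{K},\mathfrak{H})$ such that $$(K_{\infty,\rm reg})^{\frac12}=U(T_{\rm reg})^{**}\quad\text{or, equivalently,}\quad(T_{\rm reg})^{**}=U^*(K_{\infty,\rm reg})^{\frac12}.$$ Moreover, for the limit $T\in\mathbf{L}(\mathfrak{H},\mathfrak{K})$ one has (with this $U$): (a) $T$ is closable if and only if $T\subset U^*(K_{\infty,\rm reg})^{\frac12}$; (b) $T$ is closed if and only if $T=U^*(K_{\infty,\rm reg})^{\frac12}$; (c) $T$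 is singular if and only if $K_\infty$ is singular.
   Context: $\mathbf{L}(\mathfrak{H},\mathfrak{K})$ is the class of all linear relations (linear subspaces of $\mathfrak{H}\times\mathfrak{K}$) between Hilbert spaces; $\mathbf{L}(\mathfrak{H})=\mathbf{L}(\mathfrak{H},\mathfrak{H})$; $\mathbf{B}(\mathfrak{K},\mathfrak{H})$ is the class of bounded everywhere defined operators. For a relation $T$, $\operatorname{mul}T=\{f':\{0,f'\}\in T\}$; $T$ is an operator if $\operatorname{mul}T=\{0\}$ (domains need not be dense). The adjoint is $T^*=\{\{g,g'\}\in\mathfrak{K}\times\mathfrak{H}:(g',f)=(g,f')\text{ for all }\{f,f'\}\in T\}$ and $T^{**}$ is the closure of $T$; an operator $T$ is closable if $T^{**}$ is an operator, closed if $T=T^{**}$. Products are $ST=\{\{f,f'\}:\{f,h\}\in T,\{h,f'\}\in S\text{ for some }h\}$. For linear operators, $A\prec_cB$ (contractive domination: $CB\subset A$ for some contraction $C$) is equivalent to $\operatorname{dom}B\subset\operatorname{dom}A$ and $\|Af\|\le\|Bf\|$ for $f\in\operatorname{dom}B$. Under the hypothesis the domains $\operatorname{dom}T_n$ are nondecreasing in $n$; $\|T_n\varphi\|\searrow\|T\varphi\|$ denotes nonincreasing convergence along all $n$ with $\varphi\in\operatorname{dom}T_n$. Regular part: $T_{\rm reg}=(I-P)T=\{\{f,(I-P)f'\}:\{f,f'\}\in T\}$, with $P$ the orthogonal projection of $\mathfrak{K}$ onto $\operatorname{mul}T^{**}$; it is a closable operator. A relation is singular if its closure is the product $\mathfrak{A}\times\mathfrak{B}$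 of closed linear subspaces. Nonnegative selfadjoint relations: $K=K^*$ with $(f',f)\ge0$ for all $\{f,f'\}\in K$. $K_{\rm reg}$ is then a nonnegative selfadjoint operator in $\overline{\operatorname{dom}}\,K=(\operatorname{mul}K)^\perp$, and $(K_{\rm reg})^{\frac12}$ is its square root there; $K^{\frac12}$ is the nonnegative selfadjoint relation with $K^{\frac12}K^{\frac12}=K$, and $(K^{\frac12})_{\rm reg}=(K_{\rm reg})^{\frac12}$. The order $H_1\le H_2$ means $\operatorname{dom}H_2^{\frac12}\subset\operatorname{dom}H_1^{\frac12}$ and $\|(H_{1,\rm reg})^{\frac12}f\|\le\|(H_{2,\rm reg})^{\frac12}f\|$ for $f\in\operatorname{dom}H_2^{\frac12}$. For closed $T_n$ the product $T_n^*T_n$ is nonnegative and selfadjoint, and $T_n\prec_cT_m$ implies $K_n\le K_m$. By the known monotonicity principle a nonincreasing sequence of nonnegative selfadjoint relations $K_n$ has a nonnegative selfadjoint limit $K_\infty$ in the strong resolvent sense (i.e. $(K_n-\lambda)^{-1}\to(K_\infty-\lambda)^{-1}$ strongly for $\lambda\in\mathbb{C}\setminus[0,\infty)$), equivalently in the strong graph sense ($K_\infty$ consists of all limits of sequences $\{h_n,h_n'\}\in K_n$). It satisfies $K_\infty\le K_n$, $\operatorname{ran}(K_\infty)^{\frac12}=\{\varphi\in\bigcap_n\operatorname{ran}(K_n)^{\frac12}:\lim_{n\to\infty}\|((K_n)^{-\frac12})_{\rm reg}\varphi\|<\infty\}$, and $\|((K_n)^{-\frac12})_{\rm reg}\varphi\|\nearrow\|((K_\infty)^{-\frac12})_{\rm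 reg}\varphi\|$ for $\varphi\in\operatorname{ran}(K_\infty)^{\frac12}$. *)

(* Defs.v *)
From mathcomp Require Import all_boot all_order all_algebra.
From mathcomp Require Import sesquilinear.
From mathcomp.real_closed Require Export complex.
From mathcomp Require Import all_classical all_reals all_analysis.

Set Implicit Arguments.
Unset Strict Implicit.
Unset Printing Implicit Defensive.

Import Order.TTheory GRing.Theory Num.Theory.
Import numFieldNormedType.Exports.
Local Open Scope classical_set_scope.
Local Open Scope ring_scope.

(* [{dot _ for _}] forms are linear in the first argument and conjugate-linear
   in the second. *)
Record hilbertType (R : realType) := Hilbert {
  hilbert_carrier :> completeNormedModType R[i];
  inner : {dot hilbert_carrier for @Num.conj R[i]};
  inner_norm : forall x : hilbert_carrier, `|x| ^+ 2 = inner x x }.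

Definition linear_subspace (F : nzRingType) (V : lmodType F) (M : set V) :=
  M 0 /\ forall a u v, M u -> M v -> M (a *: u + v).

(* Linear relations from H to K are linear subspaces of H * K. The domain of S
   is S.`1, and the product S T (T is applied first) is (S \; T)%relation. *)
Section relations.
Context {R : realType}.
Implicit Types H K : hilbertType R.

Definition mul H K (T : set (H * K)) : set K := [set k | T (0, k)].

Definition linear_operator H K (T : set (H * K)) :=
  linear_subspace T /\ mul T = [set 0].

(* The value of an operator; 0 outside its domain. *)
Definition opval H K (T : set (H * K)) (f : H) : K := xget 0 [set k | T (f, k)].

Definition graph H K (C : H -> K) : set (H * K) := [set p | p.2 = C p.1].

Definition adj H K (T : set (H * K)) : set (K * H) :=
  [set g | forall f, T f -> inner H g.2 f.1 = inner K g.1 f.2].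

Definition closed_relation H K (T : set (H * K)) := adj (adj T) = T.

Definition closable H K (T : set (H * K)) := mul (adj (adj T)) = [set 0].

Definition singular H K (T : set (H * K)) :=
  exists (A : set H) (B : set K),
    [/\ linear_subspace A, closed A, linear_subspace B, closed B &
        adj (adj T) = A `*` B].

Definition contractively_dominated H K1 K2
    (A : set (H * K1)) (B : set (H * K2)) :=
  exists C : {linear K2 -> K1},
    (forall k, `|C k| <= `|k|) /\ (graph C \; B)%relation `<=` A.

(* Meaningful for a closed linear subspace M. *)
Definition orthproj K (M : set K) (k : K) : K :=
  xget 0 [set p | M p /\ forall m, M m -> inner K (k - p) m = 0].

Definition reg H K (T : set (H * K)) : set (H * K) :=
  [set p | exists2 k, T (p.1, k) & p.2 = k - orthproj (mul (adj (adj T))) k].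

Definition nonneg H (K : set (H * H)) :=
  forall f, K f -> 0 <= inner H f.2 f.1.

(* Selfadjointness in the Hilbert space M, a closed linear subspace of H: the
   adjoint is taken in M * M. *)
Definition selfadjoint_in H (M : set H) (K : set (H * H)) :=
  K = adj K `&` (M `*` M) /\ K `<=` M `*` M.

Definition nonneg_selfadjoint_in H (M : set H) (K : set (H * H)) :=
  selfadjoint_in M K /\ nonneg K.

Definition nonneg_selfadjoint H (K : set (H * H)) :=
  adj K = K /\ nonneg K.

Definition sqrt_in H (M : set H) (K : set (H * H)) : set (H * H) :=
  xget set0 [set S | nonneg_selfadjoint_in M S /\ (S \; S)%relation = K].

(* (K_reg)^(1/2), the square root being taken in the closure of dom K, where
   K_reg is selfadjoint when K is. *)
Definition sqrt_reg H (K : set (H * H)) : set (H * H) :=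
  sqrt_in (closure K.`1) (reg K).

(* (K - lambda)^{-1} *)
Definition resolvent H (K : set (H * H)) (lambda : R[i]) : set (H * H) :=
  [set p | K (p.2, p.1 + lambda *: p.2)].

(* In the order of R[i], 0 <= lambda says that lambda is in [0, +oo[. For
   nonnegative selfadjoint relations the resolvents are everywhere defined
   operators at every other lambda, so the default of opval plays no role. *)
Definition strong_resolvent_limit H (Kn : nat -> set (H * H))
    (K : set (H * H)) :=
  forall lambda : R[i], ~~ (0 <= lambda) -> forall h : H,
    opval (resolvent (Kn n) lambda) h @[n --> \oo] -->
    opval (resolvent K lambda) h.

Definition strong_graph_limit H (Kn : nat -> set (H * H)) (K : set (H * H)) :=
  K = [set p | exists2 u : nat -> H * H,
                 (forall n, Kn n (u n)) & u n @[n --> \oo] --> p].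

(* dom T_n may fail to contain f for small n, where opval is 0; this affects
   neither the limit nor the monotonicity clause. *)
Definition norm_decreasing_to H (Kn : nat -> hilbertType R) K
    (Tn : forall n, set (H * Kn n)) (T : set (H * K)) :=
  forall f : H, T.`1 f ->
    (forall m n, (m <= n)%N -> (Tn m).`1 f -> (Tn n).`1 f ->
       `|opval (Tn n) f| <= `|opval (Tn m) f|) /\
    (`|opval (Tn n) f| @[n --> \oo] --> `|opval T f|).

Definition partial_isometry H K (U : {linear K -> H}) :=
  continuous U /\
  forall k, (forall l, U l = 0 -> inner K k l = 0) -> `|U k| = `|k|.

End relations.

(* Main.v *)
From HB Require Import structures.
Require Import Defs.
From mathcomp Require Import all_boot all_order all_algebra.
From mathcomp Require Import all_classical all_reals all_analysis.
From mathcomp Require Import sesquilinear ring lra.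

Set Implicit Arguments.
Unset Strict Implicit.
Unset Printing Implicit Defensive.

Import Order.TTheory GRing.Theory Num.Theory.
Import numFieldNormedType.Exports.
Local Open Scope classical_set_scope.
Local Open Scope ring_scope.
Local Open Scope complex_scope.

(** Write A for [adj T \; adj (adj T)], the product of the adjoint of [T] with
    its closure.

    Identification of the limit.  The pair [(f, k)] in the closure of [T] with
    [(k, h - f)] in [adj T] exists for every [h], being the projection of
    [(h, 0)] onto the closure of [T].  Hence A is selfadjoint and
    [f = (A + 1)^-1 h] is the minimizer of [|y|^2 + |x - h|^2] over the pairs
    [(x, y)] of the closure; moreover the excess of the functional over its
    minimum is exactly [|y - k|^2 + |x - f|^2] ([min_identity]).  The same
    holds for each [T_n].  The n-th minimum dominates the limit functional at
    its minimizer, and is at most the n-th functional at any fixed point of the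
    domain of [T], where that functional tends to the limit one.  So the excess
    at the n-th minimizer tends to 0, which forces the resolvents of the [K_n] at -1 to converge strongly to that of A
    ([resolvents_converge]).  Either notion of limit then gives an inclusion
    between the selfadjoint relations [Kinf] and A, and selfadjoint relations
    are maximal ([limit_gram]).

    The square root.  With [J = (A + 1)^-1], a bounded operator with
    [0 <= J <= 1], let P and Q be the positive square roots of J and [1 - J].
    They commute and satisfy [P^2 + Q^2 = 1], so that [{(P x, Q x)}], with [x]
    in the closure of the domain of A, is a selfadjoint relation whose square
    is [{(J x, x - J x)}], the regular part of A.  Any other nonnegative root S
    yields the positive operator S J, whose square is [J (1 - J)]; it must
    therefore be P Q, and this determines S ([rootrel_unique]).  Bounded square
    roots are limits of the iteration [X |-> (Y + X^2) / 2] with [Y = 1 - J]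
    ([square_root]).

    The partial isometry.  Let B be the closure of the regular part of [T],
    that is, the part of the closure of [T] whose values are orthogonal to its
    multivalued part ([adjadj_reg]).  For [h] in the space put [D h = B (J h)].
    Then [|P Q h| = |D h|], so [D h |-> P Q h] extends to a partial isometry
    [U].  Since the pairs [(J h, D h)] form a core of B and the pairs
    [(J h, P Q h)] a core of the square root S, [U] carries B to S, and the
    partial isometry of the opposite direction carries S to B ([polar]).  The
    assertions about closable, closed and singular [T] are read off from this
    factorization and from the shape of A. *)

(** * Projections for complete hermitian forms *)

(** A hermitian form, abstracted from the norm and the topology so that the
    projection theorem applies both to a Hilbert space and to the product of two
    of them, whose product norm is a maximum and not Hilbertian.  Definiteness
    is left to the instances. *)
Record complete_form (R : realType) (V : lmodType R[i]) := CompleteForm {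
  form :> V -> V -> R[i];
  formDZl : forall a x y z, form (a *: x + y) z = a * form x z + form y z;
  formC : forall x y, form y x = (form x y)^*;
  form_ge0 : forall x, 0 <= complex.Re (form x x);
  form_complete : forall u : nat -> V,
    (forall e : R, 0 < e -> exists N, forall m n, (N <= m)%N -> (N <= n)%N ->
       complex.Re (form (u m - u n) (u m - u n)) < e) ->
    exists p, forall e : R, 0 < e -> exists N, forall n, (N <= n)%N ->
       complex.Re (form (u n - p) (u n - p)) < e }.

Section Form.
Context {R : realType} {V : lmodType R[i]} (c : complete_form V).

Definition nsq x := complex.Re (c x x).
Definition rip x y := complex.Re (c x y).

(** Closures are taken in this metric form: a relation is compared with its
    double adjoint without a topology on the graph space. *)
Definition adh (L : set V) : set V :=
  [set p | forall e : R, 0 < e -> exists2 u, L u & nsq (p - u) < e].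

Lemma form0l y : c 0 y = 0.
Proof.
have := formDZl c (-1) 0 0 y.
by rewrite scaler0 add0r mulN1r addNr.
Qed.
Lemma formZl a x y : c (a *: x) y = a * c x y.
Proof. by rewrite -[a *: x]addr0 formDZl form0l addr0. Qed.
Lemma formDl x y z : c (x + y) z = c x z + c y z.
Proof. by rewrite -{1}[x]scale1r formDZl mul1r. Qed.
Lemma formNl x z : c (- x) z = - c x z.
Proof. by rewrite -scaleN1r formZl mulN1r. Qed.
Lemma formBl x y z : c (x - y) z = c x z - c y z.
Proof. by rewrite formDl formNl. Qed.
Lemma form0r y : c y 0 = 0.
Proof. by rewrite formC form0l conjc0. Qed.
Lemma formZr a x y : c x (a *: y) = a^* * c x y.
Proof. by rewrite formC formZl rmorphM /= -formC. Qed.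
Lemma formDr x y z : c x (y + z) = c x y + c x z.
Proof. by rewrite formC formDl rmorphD /= -!formC. Qed.
Lemma formNr x z : c x (- z) = - c x z.
Proof. by rewrite formC formNl rmorphN /= -formC. Qed.
Lemma formBr x y z : c x (y - z) = c x y - c x z.
Proof. by rewrite formDr formNr. Qed.

Lemma ReZ (t : R) z : complex.Re (t%:C * z) = t * complex.Re z.
Proof. by case: z => a b /=; rewrite mul0r subr0. Qed.
Lemma ReD (y z : R[i]) : complex.Re (y + z) = complex.Re y + complex.Re z.
Proof. by case: y z => [? ?] [? ?]. Qed.
Lemma ReN (z : R[i]) : complex.Re (- z) = - complex.Re z.
Proof. by case: z => [? ?]. Qed.

Lemma ripDl x y z : rip (x + y) z = rip x z + rip y z.
Proof. by rewrite /rip formDl ReD. Qed.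
Lemma ripNl x z : rip (- x) z = - rip x z.
Proof. by rewrite /rip formNl ReN. Qed.
Lemma ripBl x y z : rip (x - y) z = rip x z - rip y z.
Proof. by rewrite ripDl ripNl. Qed.
Lemma ripC x y : rip x y = rip y x.
Proof. by rewrite /rip formC; case: (c _ _). Qed.
Lemma ripDr x y z : rip z (x + y) = rip z x + rip z y.
Proof. by rewrite ripC ripDl !(ripC z). Qed.
Lemma ripNr x z : rip z (- x) = - rip z x.
Proof. by rewrite ripC ripNl ripC. Qed.
Lemma ripBr x y z : rip z (x - y) = rip z x - rip z y.
Proof. by rewrite ripDr ripNr. Qed.
Lemma ripZl (t : R) x y : rip (t%:C *: x) y = t * rip x y.
Proof. by rewrite /rip formZl ReZ. Qed.
Lemma ripZr (t : R) x y : rip x (t%:C *: y) = t * rip x y.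
Proof. by rewrite ripC ripZl ripC. Qed.
Lemma nsq_ge0 x : 0 <= nsq x. Proof. exact: form_ge0. Qed.
Lemma nsqE x : nsq x = rip x x. Proof. by []. Qed.
Lemma nsqB x y : nsq (x - y) = nsq x - 2 * rip x y + nsq y.
Proof. rewrite !nsqE ripBl !ripBr (ripC y x); ring. Qed.
Lemma nsqD x y : nsq (x + y) = nsq x + 2 * rip x y + nsq y.
Proof. rewrite !nsqE ripDl !ripDr (ripC y x); ring. Qed.
Lemma nsqN x : nsq (- x) = nsq x.
Proof. by rewrite !nsqE ripNl ripNr opprK. Qed.
Lemma nsqZ (t : R) x : nsq (t%:C *: x) = t ^+ 2 * nsq x.
Proof. rewrite !nsqE ripZl ripZr; ring. Qed.

(** Recovers the imaginary part of the form from the real one, so that complex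
    orthogonality can be tested on real parts. *)
Lemma ripI x y : rip ('i *: x) y = - complex.Im (c x y).
Proof. by rewrite /rip formZl; case: (c _ _) => a b /=; ring. Qed.

(** A quadratic polynomial without sign change has a nonpositive discriminant;
    the statement covers the degenerate leading coefficient [a = 0]. *)
Lemma quadratic_discr (a b e : R) : 0 <= a ->
  (forall t : R, 0 <= e - 2 * t * b + t ^+ 2 * a) -> b ^+ 2 <= e * a.
Proof.
move=> a0 H; have [a1|a1] := eqVneq a 0.
- subst a; have [->|b0] := eqVneq b 0; first by rewrite expr0n mulr0.
  have := H ((e + 1) / (2 * b)).
  have -> : 2 * ((e + 1) / (2 * b)) * b = e + 1 by field.
  rewrite !mulr0; lra.
- have {a1}a0 : 0 < a by rewrite lt0r a1.
  have := H (b / a).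
  have -> : e - 2 * (b / a) * b + (b / a) ^+ 2 * a = e - b ^+ 2 / a.
    by field; rewrite gt_eqF.
  by rewrite subr_ge0 ler_pdivrMr.
Qed.

Lemma cauchy_schwarz x y : rip x y ^+ 2 <= nsq x * nsq y.
Proof.
apply: quadratic_discr (nsq_ge0 y) _ => t.
have := nsq_ge0 (x - t%:C *: y).
by rewrite nsqB ripZr nsqZ; congr (_ <= _); ring.
Qed.

(** The form in which limits are taken: Cauchy-Schwarz bounds a fixed square by
    [e * C] with [e] arbitrary. *)
Lemma small_eq0 (x C : R) : 0 <= C ->
  (forall e : R, 0 < e -> x ^+ 2 <= e * C) -> x = 0.
Proof.
move=> C0 H; have [//|x0] := eqVneq x 0; exfalso.
have xx : 0 < x ^+ 2 by rewrite exprn_even_gt0.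
have C2 : 0 < 2 * (C + 1) by rewrite mulr_gt0 // ltr_wpDl.
pose k := x ^+ 2 / (2 * (C + 1)).
have k0 : 0 < k by rewrite /k divr_gt0.
have kx : x ^+ 2 = k * (2 * (C + 1)) by rewrite /k divfK // gt_eqF.
have := H k k0; rewrite kx.
have : 0 <= k * C by rewrite mulr_ge0 // ltW.
lra.
Qed.

Lemma form_eq0_rip x y : rip x y = 0 -> rip ('i *: x) y = 0 -> c x y = 0.
Proof.
rewrite ripI /rip; case: (c x y) => a b /= -> /eqP; rewrite oppr_eq0 => /eqP ->.
by [].
Qed.

Lemma adh_rip (L : set V) p y : adh L p -> (forall u, L u -> rip u y = 0) ->
  rip p y = 0.
Proof.
move=> Lp Ly; apply: (small_eq0 (nsq_ge0 y)) => e e0.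
have [u Lu pu] := Lp e e0.
have -> : rip p y = rip (p - u) y by rewrite ripBl (Ly _ Lu) subr0.
apply: le_trans (cauchy_schwarz _ _) _.
by apply: ler_wpM2r; [exact: nsq_ge0 | exact: ltW].
Qed.

(** Orthogonal complements are closed.  The imaginary part is handled by moving
    the factor ['i] to the second argument. *)
Lemma adh_perp (L : set V) p y : adh L p -> (forall u, L u -> c u y = 0) ->
  c p y = 0.
Proof.
move=> Lp Ly; apply: form_eq0_rip.
  by apply: (adh_rip Lp) => u Lu; rewrite /rip Ly.
have -> : rip ('i *: p) y = rip p (- ('i *: y)).
  rewrite ripI /rip formNr formZr; case: (c p y) => a b /=; ring.
apply: (adh_rip Lp) => u Lu.
by rewrite /rip formNr formZr Ly // mulr0 oppr0.
Qed.

Lemma form_self_eq0 x : c x x = 0 -> nsq x = 0.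
Proof. by rewrite /nsq => ->. Qed.

(** A minimizing sequence for the distance from [z] to [L].  The parallelogram
    identity bounds the gaps, and varying a near-minimizer along [l] bounds its
    defect of orthogonality. *)
Lemma approx_proj (L : set V) z : linear_subspace L ->
  exists (u : nat -> V), [/\ forall n, L (u n),
    forall m n, nsq (u m - u n) <= 2 * (m.+1%:R^-1 + n.+1%:R^-1) &
    forall n l, L l -> rip (z - u n) l ^+ 2 <= n.+1%:R^-1 * nsq l].
Proof.
move=> [L0 LL].
pose A := [set r | exists2 l, L l & r = nsq (z - l)].
have A0 : A !=set0 by exists (nsq (z - 0)); exists 0.
have lA : has_lbound A by exists 0 => _ [l _ ->]; exact: nsq_ge0.
have infA : has_inf A by [].
(* Squared distance from z to L. *)
pose d := inf A.
have dl l : L l -> d <= nsq (z - l) by move=> Ll; apply: ge_inf => //; exists l.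
have /choice [u Hu] : forall n : nat, exists l, L l /\ nsq (z - l) < d + n.+1%:R^-1.
  move=> n; have e0 : (0 : R) < n.+1%:R^-1 by rewrite invr_gt0 ltr0n.
  by have [_ [l Ll ->] ?] := inf_adherent e0 infA; exists l.
exists u; split.
- by move=> n; case: (Hu n).
- move=> i j; have [Li ui] := Hu i; have [Lj uj] := Hu j.
  pose w := (2^-1 : R)%:C *: (u i + u j).
  have Lw : L w.
    rewrite /w -[_ *: _]addr0; apply: (LL) => //.
    by rewrite -[u i]scale1r; apply: LL.
  have := dl _ Lw.
  have -> : nsq (z - w) = 2^-1 * nsq (z - u i) + 2^-1 * nsq (z - u j)
             - 4^-1 * nsq (u i - u j).
    by rewrite /w !nsqB nsqZ ripZr nsqD ripDr; field.
  move: ui uj; set a := (i.+1%:R^-1); set b := (j.+1%:R^-1); lra.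
- move=> n l Ll; have [Ln un] := Hu n.
  apply: quadratic_discr (nsq_ge0 l) _ => t.
  have := dl (t%:C *: l + u n) (LL _ _ _ Ll Ln).
  have -> : z - (t%:C *: l + u n) = (z - u n) - t%:C *: l by rewrite opprD addrCA addrC.
  rewrite nsqB nsqZ ripZr; move: un.
  set a := (n.+1%:R^-1); lra.
Qed.

Lemma small_inv (e : R) : 0 < e -> exists N, forall n, (N <= n)%N -> n.+1%:R^-1 < e.
Proof.
move=> e0; exists (Num.truncn e^-1) => n Nn.
rewrite invf_plt ?posrE ?ltr0n //.
apply: lt_le_trans (truncnS_gt _) _.
by rewrite ler_nat ltnS.
Qed.

Lemma form_rip0 (L : set V) x : linear_subspace L ->
  (forall l, L l -> rip x l = 0) -> forall l, L l -> c x l = 0.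
Proof.
move=> [L0 LL] H l Ll; rewrite formC.
suff -> : c l x = 0 by rewrite conjc0.
apply: form_eq0_rip; rewrite ripC; apply: H => //.
by rewrite -[_ *: _]addr0; apply: LL.
Qed.

(** The projection of [z] on the closure of [L]: the limit of a minimizing
    sequence, orthogonality passing to the limit. *)
Lemma projection (L : set V) z : linear_subspace L ->
  exists2 p, adh L p & forall l, L l -> c (z - p) l = 0.
Proof.
move=> sL; have [u [Lu cu ou]] := approx_proj z sL.
have [p up] : exists p, forall e : R, 0 < e -> exists N, forall n, (N <= n)%N ->
    nsq (u n - p) < e.
  apply: form_complete => e e0.
  have e4 : 0 < e / 4 by rewrite divr_gt0.
  have [N HN] := small_inv e4; exists N => m n Nm Nn.
  apply: le_lt_trans (cu m n) _; have := HN _ Nm; have := HN _ Nn.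
  set a := (m.+1%:R^-1); set b := (n.+1%:R^-1); lra.
exists p.
  move=> e e0; have [N HN] := up e e0; exists (u N) => //.
  by rewrite -nsqN opprB HN.
apply: form_rip0 => // l Ll.
apply: (@small_eq0 _ (4 * nsq l)); first by rewrite mulr_ge0 ?nsq_ge0.
move=> e e0.
have [N1 H1] := small_inv e0; have [N2 H2] := up e e0.
pose n := maxn N1 N2.
have /H1 h1 : (N1 <= n)%N by rewrite leq_maxl.
have /H2 h2 : (N2 <= n)%N by rewrite leq_maxr.
have -> : rip (z - p) l = rip (z - u n) l + rip (u n - p) l.
  by rewrite -ripDl addrA subrK.
have := ou n l Ll; have := cauchy_schwarz (u n - p) l.
have := nsq_ge0 l; move: h1 h2.
set a := n.+1%:R^-1; set b := nsq (u n - p); set x := rip _ _; set y := rip _ _.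
set N := nsq l => h1 h2 N0 hx hy.
have : a * N <= e * N by rewrite ler_wpM2r // ltW.
have : b * N <= e * N by rewrite ler_wpM2r // ltW.
have : 0 <= (x - y) ^+ 2 by rewrite sqr_ge0.
have -> : (y + x) ^+ 2 = 2 * x ^+ 2 + 2 * y ^+ 2 - (x - y) ^+ 2 by ring.
nra.
Qed.

Lemma adhS (L : set V) : L `<=` adh L.
Proof. by move=> x Lx e e0; exists x; rewrite // subrr nsqE /rip form0l. Qed.

End Form.

(** * Hilbert spaces and graph spaces *)

Section HilbertForm.
Context {R : realType}.
Implicit Types H K : hilbertType R.

Lemma innerDZl H (a : R[i]) (x y z : H) :
  inner H (a *: x + y) z = a * inner H x z + inner H y z.
Proof. exact: linearPl. Qed.

Lemma innerC H (x y : H) : inner H y x = (inner H x y)^*.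
Proof. by rewrite hermC expr0 mul1r. Qed.

Lemma inner_ge0 H (x : H) : 0 <= inner H x x.
Proof. by rewrite -inner_norm exprn_ge0. Qed.

Lemma Re_inner_norm H (x : H) :
  complex.Re (inner H x x) = complex.Re `|x| ^+ 2 /\ `|x| = (complex.Re `|x|)%:C.
Proof.
have E : `|x| = (complex.Re `|x|)%:C by rewrite RRe_real // ger0_real.
by split=> //; rewrite -inner_norm {1}E -rmorphXn.
Qed.

Lemma inner_norm_lt H (x : H) (e : R) : 0 < e ->
  (`|x| < e%:C) = (complex.Re (inner H x x) < e ^+ 2).
Proof.
move=> e0; have [-> E] := Re_inner_norm x; rewrite {1}E ltcR.
by rewrite ltr_pXn2r // nnegrE ?(ltW e0) // -ler0c -E.
Qed.

Lemma inner_norm_le H K (x : H) (y : K) :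
  (`|x| <= `|y|) = (complex.Re (inner H x x) <= complex.Re (inner K y y)).
Proof.
have [-> Ex] := Re_inner_norm x; have [-> Ey] := Re_inner_norm y.
rewrite {1}Ex {1}Ey lecR ler_pXn2r // nnegrE -ler0c -?Ex -?Ey //.
Qed.

Lemma inner_complete H (u : nat -> H) :
  (forall e : R, 0 < e -> exists N, forall m n, (N <= m)%N -> (N <= n)%N ->
     complex.Re (inner H (u m - u n) (u m - u n)) < e) ->
  exists p, forall e : R, 0 < e -> exists N, forall n, (N <= n)%N ->
     complex.Re (inner H (u n - p) (u n - p)) < e.
Proof.
move=> cu.
have : cvg (u @ \oo).
  apply: cauchy_cvg; apply: cauchy_exP => e e0.
  have Ee : e = (complex.Re e)%:C by rewrite RRe_real // gtr0_real.
  have e1 : 0 < complex.Re e by move: e0; rewrite {1}Ee ltcR.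
  have [N HN] := cu _ (exprn_gt0 2 e1).
  exists (u N); exists N => // n /= Nn.
  rewrite -ball_normE /ball_ /= Ee inner_norm_lt //.
  exact: HN.
move=> /cvg_ex [p up]; exists p => e e0.
have s0 : 0 < Num.sqrt e by rewrite sqrtr_gt0.
move/cvgrPdist_lt : up => /(_ (Num.sqrt e)%:C); rewrite ltcR => /(_ s0) [N _ HN].
exists N => n Nn; have := HN n Nn.
by rewrite distrC inner_norm_lt // sqr_sqrtr // ltW.
Qed.

Lemma inner_Re_ge0 H (x : H) : 0 <= complex.Re (inner H x x).
Proof. by have := inner_ge0 x; rewrite lecE => /andP[]. Qed.

Definition hilbert_form H : complete_form H :=
  CompleteForm (@innerDZl H) (@innerC H) (@inner_Re_ge0 H) (@inner_complete H).

Definition pair_inner H K (p q : H * K) : R[i] :=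
  inner H p.1 q.1 + inner K p.2 q.2.

Lemma pair_innerDZl H K (a : R[i]) (x y z : H * K) :
  pair_inner (a *: x + y) z = a * pair_inner x z + pair_inner y z.
Proof. by rewrite /pair_inner /= !innerDZl; ring. Qed.

Lemma pair_innerC H K (x y : H * K) : pair_inner y x = (pair_inner x y)^*.
Proof. by rewrite /pair_inner rmorphD /= -!innerC. Qed.

Lemma pair_inner_ge0 H K (x : H * K) : 0 <= complex.Re (pair_inner x x).
Proof. by rewrite /pair_inner ReD addr_ge0 // inner_Re_ge0. Qed.

Lemma pair_complete H K (u : nat -> H * K) :
  (forall e : R, 0 < e -> exists N, forall m n, (N <= m)%N -> (N <= n)%N ->
     complex.Re (pair_inner (u m - u n) (u m - u n)) < e) ->
  exists p, forall e : R, 0 < e -> exists N, forall n, (N <= n)%N ->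
     complex.Re (pair_inner (u n - p) (u n - p)) < e.
Proof.
move=> cu.
have [p1 H1] : exists p, forall e : R, 0 < e -> exists N, forall n, (N <= n)%N ->
    complex.Re (inner H ((u n).1 - p) ((u n).1 - p)) < e.
  apply: inner_complete => e e0; have [N HN] := cu e e0; exists N => m n Nm Nn.
  apply: le_lt_trans (HN m n Nm Nn).
  by rewrite /pair_inner ReD /= lerDl inner_Re_ge0.
have [p2 H2] : exists p, forall e : R, 0 < e -> exists N, forall n, (N <= n)%N ->
    complex.Re (inner K ((u n).2 - p) ((u n).2 - p)) < e.
  apply: inner_complete => e e0; have [N HN] := cu e e0; exists N => m n Nm Nn.
  apply: le_lt_trans (HN m n Nm Nn).
  by rewrite /pair_inner ReD /= lerDr inner_Re_ge0.
exists (p1, p2) => e e0.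
have e2 : 0 < e / 2 by rewrite divr_gt0.
have [N1 {}H1] := H1 _ e2; have [N2 {}H2] := H2 _ e2.
exists (maxn N1 N2) => n; rewrite geq_max => /andP[/H1 h1 /H2 h2].
rewrite /pair_inner ReD /= [e]splitr; exact: ltrD.
Qed.

Definition graph_form H K : complete_form (H * K)%type :=
  CompleteForm (@pair_innerDZl H K) (@pair_innerC H K)
    (@pair_inner_ge0 H K) (@pair_complete H K).

Section InnerTheory.
Variable H : hilbertType R.
Implicit Types x y z : H.
Lemma inner0l y : inner H 0 y = 0. Proof. exact: (form0l (hilbert_form H)). Qed.
Lemma inner0r y : inner H y 0 = 0. Proof. exact: (form0r (hilbert_form H)). Qed.
Lemma innerDl x y z : inner H (x + y) z = inner H x z + inner H y z.
Proof. exact: (formDl (hilbert_form H)). Qed.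
Lemma innerDr x y z : inner H x (y + z) = inner H x y + inner H x z.
Proof. exact: (formDr (hilbert_form H)). Qed.
Lemma innerBl x y z : inner H (x - y) z = inner H x z - inner H y z.
Proof. exact: (formBl (hilbert_form H)). Qed.
Lemma innerBr x y z : inner H x (y - z) = inner H x y - inner H x z.
Proof. exact: (formBr (hilbert_form H)). Qed.
Lemma innerNl x z : inner H (- x) z = - inner H x z.
Proof. exact: (formNl (hilbert_form H)). Qed.
Lemma innerNr x z : inner H x (- z) = - inner H x z.
Proof. exact: (formNr (hilbert_form H)). Qed.
Lemma innerZl a x z : inner H (a *: x) z = a * inner H x z.
Proof. exact: (formZl (hilbert_form H)). Qed.
Lemma innerZr a x z : inner H x (a *: z) = a^* * inner H x z.
Proof. exact: (formZr (hilbert_form H)). Qed.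
Lemma inner_eq0C x y : inner H x y = 0 -> inner H y x = 0.
Proof. by move=> h; rewrite innerC h conjc0. Qed.
End InnerTheory.

Lemma nsqP H K (p : H * K) :
  nsq (graph_form H K) p = nsq (hilbert_form H) p.1 + nsq (hilbert_form K) p.2.
Proof. by rewrite /nsq /= /pair_inner ReD. Qed.

Lemma nsq_eq0 H (x : H) : nsq (hilbert_form H) x = 0 -> x = 0.
Proof.
rewrite /nsq /=; have [-> E] := Re_inner_norm x.
move=> /eqP; rewrite sqrf_eq0 => /eqP E0; apply/eqP.
by rewrite -normr_eq0 E E0.
Qed.

Lemma inner_eq0 H (x : H) : inner H x x = 0 -> x = 0.
Proof. by move=> h; apply: nsq_eq0; apply: form_self_eq0. Qed.

Lemma inner_inj H (x y : H) : (forall z, inner H x z = inner H y z) -> x = y.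
Proof.
move=> h; apply/eqP; rewrite -subr_eq0; apply/eqP; apply: inner_eq0.
by rewrite innerBl h subrr.
Qed.

(** * Orthogonal complements and adjoints *)

Definition perp H (A : set H) : set H :=
  [set x | forall a, A a -> inner H x a = 0].

Lemma perp_subspace H (A : set H) : linear_subspace (perp A).
Proof.
split=> [a _|a u v Pu Pv x Ax]; first by rewrite inner0l.
by rewrite innerDZl Pu // Pv // mulr0 addr0.
Qed.

Lemma adh_perpP H (A : set H) p : adh (hilbert_form H) (perp A) p -> perp A p.
Proof. by move=> Ap x Ax; apply: (adh_perp Ap) => u; exact. Qed.

Lemma perp_decomp H (D : set H) : linear_subspace D -> forall k,
  exists2 n, perp D n & perp (perp D) (k - n).
Proof.
move=> sD k; have [p Dp kp] := projection (hilbert_form H) k sD.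
exists (k - p) => //; rewrite opprB addrCA subrr addr0 => n Dn.
by apply: (adh_perp Dp) => u Du; apply: inner_eq0C; exact: Dn.
Qed.

(** An orthogonal complement is closed, so the projection onto it is attained.
    The multivalued part of an adjoint is of this shape. *)
Lemma orthproj_perp H (D : set H) : linear_subspace D -> forall k,
  perp D (orthproj (perp D) k) /\ perp (perp D) (k - orthproj (perp D) k).
Proof.
move=> sD k; have [n Dn Dkn] := perp_decomp sD k.
rewrite /orthproj; case: xgetP => [p _ //|/(_ n)] /=.
by case; split.
Qed.

Lemma subspaceB (V : lmodType R[i]) (A : set V) x y :
  linear_subspace A -> A x -> A y -> A (x - y).
Proof.
by case=> _ sA Ax Ay; rewrite addrC -scaleN1r; exact: sA.
Qed.
Lemma subspaceD (V : lmodType R[i]) (A : set V) x y :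
  linear_subspace A -> A x -> A y -> A (x + y).
Proof. by case=> _ sA Ax Ay; rewrite -[x]scale1r; exact: sA. Qed.
Lemma subspaceZ (V : lmodType R[i]) (A : set V) a x :
  linear_subspace A -> A x -> A (a *: x).
Proof. by case=> A0 sA Ax; rewrite -[_ *: _]addr0; exact: sA. Qed.

Lemma adh_closureE H (A : set H) : closure A = adh (hilbert_form H) A.
Proof.
apply/seteqP; split=> x.
  move=> cAx e e0; have s0 : 0 < Num.sqrt e by rewrite sqrtr_gt0.
  have [|u [Au]] := cAx (ball x (Num.sqrt e)%:C).
    by apply: nbhsx_ballx; rewrite ltcR.
  rewrite -ball_normE /ball_ /= inner_norm_lt // sqr_sqrtr ?ltW // => xu.
  by exists u.
move=> Ax B /nbhs_ballP [e /= e0 xB].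
have Ee : e = (complex.Re e)%:C by rewrite RRe_real // gtr0_real.
have e1 : 0 < complex.Re e by move: e0; rewrite {1}Ee ltcR.
have [u Au xu] := Ax _ (exprn_gt0 2 e1).
exists u; split=> //; apply: xB.
by rewrite -ball_normE /ball_ /= Ee inner_norm_lt.
Qed.

(** Turns the topological closure of the domain in [sqrt_reg] into an algebraic
    condition: the complement of the domain is the multivalued part of the
    adjoint ([mul_adj]). *)
Lemma closure_perp H (D : set H) : linear_subspace D ->
  closure D = perp (perp D).
Proof.
move=> sD; rewrite adh_closureE; apply/seteqP; split=> x.
  by move=> Dx y Dy; apply: (adh_perp Dx) => u Du; apply: inner_eq0C; exact: Dy.
move=> Dx; have [p Dp xp] := projection (hilbert_form H) x sD.
suff -> : x = p by [].
apply/eqP; rewrite -subr_eq0; apply/eqP; apply: inner_eq0.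
rewrite innerBl Dx //; apply/eqP; rewrite sub0r oppr_eq0; apply/eqP.
by apply: (adh_perp Dp) => u Du; apply: inner_eq0C; exact: xp.
Qed.

Lemma adj_subspace H K (T : set (H * K)) : linear_subspace (adj T).
Proof.
split=> [f _ /=|a u v Tu Tv f Tf /=]; first by rewrite !inner0l.
by rewrite !innerDZl Tu // Tv.
Qed.

Lemma adjS H K (S T : set (H * K)) : S `<=` T -> adj T `<=` adj S.
Proof. by move=> ST g Tg f /ST; exact: Tg. Qed.

Lemma sub_adjadj H K (T : set (H * K)) : T `<=` adj (adj T).
Proof.
move=> f Tf g Tg /=; rewrite innerC (innerC g.2).
by congr (_^*); rewrite Tg.
Qed.

Lemma adjadjadj H K (T : set (H * K)) : adj (adj (adj T)) = adj T.
Proof.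
apply/seteqP; split; last exact: sub_adjadj.
by apply: adjS; exact: sub_adjadj.
Qed.

Lemma adj_pairE H K (T : set (H * K)) (g : K * H) :
  adj T g <-> forall f, T f -> pair_inner g (f.2, - f.1) = 0.
Proof.
rewrite /pair_inner; split=> Tg f Tf /=.
  by rewrite innerNr Tg // subrr.
by have := Tg f Tf; rewrite /= innerNr => /eqP; rewrite subr_eq0 => /eqP.
Qed.

(** Adjoints are closed, because [adj T] is an orthogonal complement in the
    graph space. *)
Lemma adh_adj H K (T : set (H * K)) g : adh (graph_form K H) (adj T) g -> adj T g.
Proof.
move=> Tg; apply/adj_pairE => f Tf; apply: (adh_perp Tg) => u.
by move/adj_pairE; exact.
Qed.

(** The double adjoint is the closure.  The component of [z] orthogonal to [T],
    rotated by [(a, b) |-> (- b, a)], lies in [adj T]; that component [d] is itself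
    in [adj (adj T)], and testing it there gives [- |d.2|^2 = |d.1|^2]. *)
Lemma adjadj_adh H K (T : set (H * K)) : linear_subspace T ->
  adj (adj T) `<=` adh (graph_form H K) T.
Proof.
move=> sT z Tz; have [p Tp zp] := projection (graph_form H K) z sT.
suff -> : z = p by [].
have Tw : adj T (- (z - p).2, (z - p).1).
  move=> f Tf /=; have := zp f Tf; rewrite /= /pair_inner /= innerNl => /eqP.
  by rewrite addr_eq0 => /eqP.
have TTp : adj (adj T) p.
  apply: adh_adj => e e0; have [u Tu pu] := Tp e e0; exists u => //.
  exact: sub_adjadj.
have TTzp : adj (adj T) (z - p) := subspaceB (adj_subspace (adj T)) Tz TTp.
have := TTzp _ Tw; rewrite /= innerNr => h.
have : nsq (graph_form H K) (z - p) = 0.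
  by apply: form_self_eq0; rewrite /= /pair_inner -h addNr.
rewrite nsqP => /eqP; rewrite paddr_eq0 ?nsq_ge0 // => /andP[/eqP h1 /eqP h2].
apply/eqP; rewrite -subr_eq0; apply/eqP.
by rewrite [z - p]surjective_pairing (nsq_eq0 h1) (nsq_eq0 h2).
Qed.

Lemma mul_adj H K (T : set (H * K)) : Defs.mul (adj T) = perp T.`1.
Proof.
apply/seteqP; split=> h Th.
  by move=> f [k Tfk]; have := Th _ Tfk; rewrite /= inner0l.
by move=> [f k] Tfk /=; rewrite inner0l Th //; exists k.
Qed.

Lemma dom_subspace H K (T : set (H * K)) :
  linear_subspace T -> linear_subspace T.`1.
Proof.
case=> T0 sT; split=> [|a u v [u' Tu] [v' Tv]]; first by exists 0.
by exists (a *: u' + v'); exact: (sT a _ _ Tu Tv).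
Qed.

End HilbertForm.

(** * Selfadjointness of the product of the adjoint and the closure *)

Section SelfAdjoint.
Context {R : realType}.
Implicit Types H K : hilbertType R.

Lemma comp_subspace H K (L : hilbertType R) (S : set (K * L)) (T : set (H * K)) :
  linear_subspace S -> linear_subspace T -> linear_subspace (S \; T)%relation.
Proof.
move=> [S0 sS] [T0 sT]; split=> [|a u v [u' Tu Su] [v' Tv Sv]].
  by exists 0.
by exists (a *: u' + v'); [exact: (sT a _ _ Tu Tv) | exact: (sS a _ _ Su Sv)].
Qed.

Definition symmetric_relation H (A : set (H * H)) := A `<=` adj A.

(** If [A + 1] is onto, a pair of [adj A] has the same sum as some pair of [A],
    and symmetry together with surjectivity forces the two to coincide. *)
Lemma selfadjoint_range H (A : set (H * H)) : linear_subspace A ->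
  symmetric_relation A -> (forall h, exists f, A (f, h - f)) -> adj A = A.
Proof.
move=> sA symA rA; apply/seteqP; split=> // -[g g'] Ag.
have [f Af] := rA (g + g').
have fg : f = g.
  apply: inner_inj => h; have [u Au] := rA h.
  have := Ag _ Au; have := symA _ Af _ Au => /=.
  rewrite !innerBl innerDl !innerBr => h1 h2.
  apply/eqP; rewrite -subr_eq0; apply/eqP.
  have -> : inner H f h = inner H g u + inner H g' u - inner H f u + inner H f u.
    by rewrite h1 subrK.
  rewrite h2; ring.
by move: Af; rewrite fg addrC addKr.
Qed.

Lemma selfadjoint_max H (A B : set (H * H)) :
  adj A = A -> adj B = B -> A `<=` B -> A = B.
Proof.
move=> aA aB AB; apply/seteqP; split => //.
by rewrite -aA -aB; exact: adjS.
Qed.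

(** Projecting [(h, 0)] onto the closure of [T] solves [f + A f = h]: the
    difference [(h - f, - k)] is orthogonal to the closure. *)
Lemma gram_range H K (T : set (H * K)) h :
  exists f k, adj (adj T) (f, k) /\ adj T (k, h - f).
Proof.
have [[f k] Tp zp] := projection (graph_form H K) (h, 0) (adj_subspace (adj T)).
exists f, k; split; first exact: adh_adj.
rewrite -adjadjadj => -[x y] Txy; have := zp _ Txy.
rewrite /= /pair_inner /= sub0r innerNl => /eqP; rewrite subr_eq0 => /eqP //.
Qed.

(** The relation called A in the introduction; for an operator between finite
    dimensional spaces its matrix is the Gram matrix of the columns. *)
Definition gram H K (T : set (H * K)) : set (H * H) :=
  (adj T \; adj (adj T))%relation.

Lemma gram_subspace H K (T : set (H * K)) : linear_subspace (gram T).
Proof. by apply: comp_subspace; exact: adj_subspace. Qed.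

Lemma gram_inner H K (T : set (H * K)) f h g x y :
  adj (adj T) (f, h) -> adj T (h, g) -> adj (adj T) (x, y) ->
  inner H g x = inner K h y.
Proof.
by move=> _ Tg Txy; move: Tg; rewrite -(adjadjadj T) => /(_ _ Txy).
Qed.

Lemma gram_sa H K (T : set (H * K)) : adj (gram T) = gram T.
Proof.
apply: selfadjoint_range; first exact: gram_subspace.
  move=> [f g] [h Tfh Thg] [x z] [y Txy Tyz] /=.
  rewrite (gram_inner Tfh Thg Txy) innerC -(gram_inner Txy Tyz Tfh).
  by rewrite -innerC.
by move=> h; have [f [k [? ?]]] := gram_range T h; exists f, k.
Qed.

Lemma gram_nonneg H K (T : set (H * K)) : nonneg (gram T).
Proof.
move=> [f g] [h Tfh Thg] /=.
by rewrite (gram_inner Tfh Thg Tfh) inner_ge0.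
Qed.

(** Completing the square: the cross terms cancel because [(k, h - f)] is in
    [adj T]. *)
Lemma min_identity H K (T : set (H * K)) f k h x y :
  adj (adj T) (f, k) -> adj T (k, h - f) -> adj (adj T) (x, y) ->
  nsq (hilbert_form K) y + nsq (hilbert_form H) (x - h) =
  nsq (hilbert_form K) k + nsq (hilbert_form H) (f - h) +
  nsq (hilbert_form K) (y - k) + nsq (hilbert_form H) (x - f).
Proof.
move=> Tfk Tk Txy.
have := gram_inner Tfk Tk Txy; have := gram_inner Tfk Tk Tfk.
move=> /(congr1 (@complex.Re _)) h1 /(congr1 (@complex.Re _)) h2.
have {}h1 : rip (hilbert_form H) (h - f) f = nsq (hilbert_form K) k := h1.
have {}h2 : rip (hilbert_form H) (h - f) x = rip (hilbert_form K) k y := h2.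
rewrite !nsqB (ripC _ y k) -h2 -h1 !ripBl (ripC _ x f) (ripC _ f h) (ripC _ x h) !nsqE.
ring.
Qed.

Lemma opval_eq H K (T : set (H * K)) f k : linear_operator T ->
  T (f, k) -> opval T f = k.
Proof.
move=> [sT mT] Tfk; apply: xget_unique => // y Ty.
apply/eqP; rewrite -subr_eq0; apply/eqP.
have : Defs.mul T (y - k).
  by have := subspaceB sT Ty Tfk; rewrite /Defs.mul /= /GRing.add /= /add_pair /= subrr.
by rewrite mT.
Qed.

End SelfAdjoint.

(** * Strong convergence of the resolvents *)

Section Limit.
Context {R : realType}.
Implicit Types H K : hilbertType R.

Lemma tends_cvg H (u : nat -> H) p :
  (forall e : R, 0 < e -> exists N, forall n, (N <= n)%N ->
     nsq (hilbert_form H) (u n - p) < e) -> u n @[n --> \oo] --> p.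
Proof.
move=> up; apply/cvgrPdist_lt => e e0.
have Ee : e = (complex.Re e)%:C by rewrite RRe_real // gtr0_real.
have e1 : 0 < complex.Re e by move: e0; rewrite {1}Ee ltcR.
have [N HN] := up _ (exprn_gt0 2 e1); exists N => // n /HN h.
by rewrite Ee distrC inner_norm_lt.
Qed.

Lemma dominated_dom H K1 K2 (A : set (H * K1)) (B : set (H * K2)) f k :
  contractively_dominated A B -> B (f, k) ->
  exists2 k', A (f, k') & nsq (hilbert_form K1) k' <= nsq (hilbert_form K2) k.
Proof.
move=> [C [contrC CBA]] Bfk; exists (C k).
  by apply: CBA; exists k.
by rewrite /nsq /= -inner_norm_le.
Qed.

Lemma resolvent_unique H (A : set (H * H)) h f f' : linear_subspace A ->
  nonneg A -> A (f, h - f) -> A (f', h - f') -> f = f'.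
Proof.
move=> sA nA Af Af'; apply/eqP; rewrite -subr_eq0; apply/eqP.
have := nA _ (subspaceB sA Af Af').
have -> : (f, h - f) - (f', h - f') = (f - f', - (f - f')) :> H * H.
  rewrite /GRing.add /= /add_pair /=; congr (_, _).
  by rewrite !opprD !opprK addrACA subrr add0r addrC.
rewrite /= innerNl oppr_ge0 => ff.
by apply: inner_eq0; apply/eqP; rewrite eq_le ff inner_ge0.
Qed.

Section Sequence.
Variables (H K : hilbertType R) (KK : nat -> hilbertType R).
Variables (Tn : forall n, set (H * KK n)) (T : set (H * K)).
Arguments Tn : clear implicits.
Hypothesis Tn_op : forall n, linear_operator (Tn n).
Hypothesis Tn_closed : forall n, closed_relation (Tn n).
Hypothesis Tn_dom :
  forall m n, (m <= n)%N -> contractively_dominated (Tn n) (Tn m).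
Hypothesis T_op : linear_operator T.
Hypothesis T_domain : T.`1 = \bigcup_n (Tn n).`1.
Hypothesis T_dom : forall n, contractively_dominated T (Tn n).
Hypothesis T_lim : norm_decreasing_to Tn T.

(** The squared norms converge at [x]; the index is also taken so large that
    [x] lies in the domain of every later [Tn n]. *)
Lemma eventually_below x y (e : R) : T (x, y) -> 0 < e ->
  exists N, forall n, (N <= n)%N ->
    exists2 z, Tn n (x, z) & nsq (hilbert_form (KK n)) z < nsq (hilbert_form K) y + e.
Proof.
move=> Txy e0.
have Tx : T.`1 x by exists y.
have [m _ [z0 Tmx]] : (\bigcup_n (Tn n).`1) x by rewrite -T_domain.
have [_ lim] := T_lim Tx.
(* Passing to squares, where norms are inner products. *)
have lim2 := cvgM lim lim.
have := proj1 (@cvgrPdist_lt _ R[i]^o _ _ _ _ _) (lim2 _) e%:C.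
rewrite ltcR => /(_ _ _ e0) [N _ HN].
exists (maxn m N) => n; rewrite geq_max => /andP[mn Nn].
have [z Tz _] := dominated_dom (Tn_dom mn) Tmx.
exists z => //; have := HN n Nn.
rewrite /= (opval_eq (Tn_op n) Tz) (opval_eq T_op Txy).
change (`|y| * `|y|) with (`|y| ^+ 2); change (`|z| * `|z|) with (`|z| ^+ 2).
rewrite !inner_norm distrC => h.
have real_inner L (v : hilbert_carrier L) : inner L v v = (nsq (hilbert_form L) v)%:C.
  by rewrite /nsq /= RRe_real // ger0_real // inner_ge0.
move: h; rewrite !real_inner -rmorphB /= => h.
suff : nsq (hilbert_form (KK n)) z - nsq (hilbert_form K) y < e by rewrite ltrBlDl.
apply: le_lt_trans (ler_norm _) _; rewrite -ltcR; apply: le_lt_trans h.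
have := normc_ge_Re ((nsq (hilbert_form (KK n)) z - nsq (hilbert_form K) y)%:C); exact.
Qed.

(** Let [J_n] and [J] be the functionals minimized by [fn n] and [f].  Domination
    gives [J (fn n) <= J_n (fn n) <= J_n x], and [J_n x] drops below
    [J f + e] once [x] is close to [f] in the graph of [T].  By
    [min_identity] this bounds the distance from [fn n] to [f]. *)
Lemma resolvents_converge h (fn : nat -> H) (kn : forall n, KK n) f k :
  (forall n, Tn n (fn n, kn n) /\ adj (Tn n) (kn n, h - fn n)) ->
  adj (adj T) (f, k) -> adj T (k, h - f) -> fn n @[n --> \oo] --> f.
Proof.
move=> Hn Tfk Tk; apply: tends_cvg => e e0.
have [sT _] := T_op.
have [[x y] Txy xy] := adjadj_adh sT Tfk e0.
have J1 := min_identity Tfk Tk (sub_adjadj Txy).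
set J := nsq (hilbert_form K) k + nsq (hilbert_form H) (f - h) in J1.
(* The part of e that the choice of (x, y) has not used up. *)
pose d := e - (nsq (hilbert_form K) (y - k) + nsq (hilbert_form H) (x - f)).
have d0 : 0 < d.
  rewrite subr_gt0 addrC -(nsqN _ (x - f)) -(nsqN _ (y - k)) !opprB.
  by move: xy; rewrite nsqP.
have [N HN] := eventually_below Txy d0.
exists N => n /HN [z Tz zy].
have [Tfn Tkn] := Hn n.
have [t Tt tkn] := dominated_dom (T_dom n) Tfn.
have J2 := min_identity Tfk Tk (sub_adjadj Tt).
have J3 := min_identity (sub_adjadj Tfn) Tkn (sub_adjadj Tz).
have := nsq_ge0 (hilbert_form (KK n)) (z - kn n).
have := nsq_ge0 (hilbert_form K) (t - k).
have := nsq_ge0 (hilbert_form H) (x - fn n).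
move: J1 J2 J3 zy tkn; rewrite /d -/J; lra.
Qed.

(** In the resolvent case uniqueness of limits shows that every pair of [Kinf]
    belongs to [gram T]; in the graph case every pair of [gram T] is a limit of
    pairs of the [Kn n].  Maximality gives equality. *)
Lemma limit_gram (Kinf : set (H * H)) : nonneg_selfadjoint Kinf ->
  let Kn n := (adj (Tn n) \; Tn n)%relation in
  strong_resolvent_limit Kn Kinf \/ strong_graph_limit Kn Kinf ->
  Kinf = (adj T \; adj (adj T))%relation.
Proof.
move=> [saK nnK] Kn.
have KnE n : Kn n = gram (Tn n) by rewrite /Kn /gram Tn_closed.
have res h : exists fn f, [/\ forall n, Kn n (fn n, h - fn n),
    gram T (f, h - f) & fn n @[n --> \oo] --> f].
  have [f [k [Tfk Tk]]] := gram_range T h.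
  have /choice [fn Hfn] n : exists fn, exists kn,
      Tn n (fn, kn) /\ adj (Tn n) (kn, h - fn).
    have [fn [kn]] := gram_range (Tn n) h.
    by rewrite Tn_closed => ?; exists fn, kn.
  pose kn n := projT1 (cid (Hfn n)).
  have Hkn n : Tn n (fn n, kn n) /\ adj (Tn n) (kn n, h - fn n).
    by rewrite /kn; case: cid.
  exists fn, f; split; last exact: resolvents_converge Hkn Tfk Tk.
    by move=> n; have [? ?] := Hkn n; exists (kn n).
  by exists k.
move=> [lim|lim].
- apply: selfadjoint_max => //; first exact: gram_sa.
  move=> [f g] Kfg.
  have [fn [f0 [Kfn Kf0 fnf]]] := res (f + g).
  have sK : linear_subspace Kinf by rewrite -saK; exact: adj_subspace.
  have m1 : ~~ (0 <= -1 :> R[i]) by rewrite oppr_ge0 ler10.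
  have := lim _ m1 (f + g).
  have -> : opval (resolvent Kinf (-1)) (f + g) = f.
    apply: xget_unique => [|f' Kf'].
      by rewrite /resolvent /= scaleN1r addrC addKr.
    apply: (@resolvent_unique _ Kinf (f + g)) => //.
      by move: Kf'; rewrite /resolvent /= scaleN1r.
    by rewrite addrC addKr.
  have -> : (fun n => opval (resolvent (Kn n) (-1)) (f + g)) = fn.
    apply/funext => n; apply: xget_unique => [|f' Kf'].
      by rewrite /resolvent /= scaleN1r.
    apply: (@resolvent_unique _ (Kn n) (f + g)) => //.
    + by rewrite KnE; exact: gram_subspace.
    + by rewrite KnE; exact: gram_nonneg.
    + by move: Kf'; rewrite /resolvent /= scaleN1r.
  move=> fnf'.
  have ff0 : f = f0 := cvg_unique (@norm_hausdorff _ _) fnf' fnf.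
  have gE : f + g - f = g by rewrite addrC addKr.
  by rewrite -ff0 gE in Kf0.
- apply/esym; apply: selfadjoint_max => //; first exact: gram_sa.
  move=> [f g] Kfg.
  have [fn [f0 [Kfn Kf0 fnf]]] := res (f + g).
  have ff0 : f = f0.
    apply: (@resolvent_unique _ (gram T) (f + g)) => //.
    + exact: gram_subspace.
    + exact: gram_nonneg.
    + by rewrite addrC addKr.
  rewrite -ff0 in fnf.
  have gn : (f + g - fn n) @[n --> \oo] --> f + g - f.
    by apply: cvgB => //; exact: cvg_cst.
  rewrite [f + g - f]addrC addKr in gn.
  rewrite lim; exists (fun n => (fn n, f + g - fn n)) => //.
  exact: cvg_pair fnf gn.
Qed.

End Sequence.
End Limit.

(** * Square roots of bounded operators *)

Section SquareRoot.
Context {R : realType} {H : hilbertType R}.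
Implicit Types (A C : H -> H) (x y : H).

Notation rp := (rip (hilbert_form H)).
Notation nq := (nsq (hilbert_form H)).

Definition sym A := forall x y, inner H (A x) y = inner H x (A y).

(** An everywhere defined symmetric map is linear, so no linear structure needs
    to be carried along with the operators below. *)
Lemma sym_linear A a x y : sym A -> A (a *: x + y) = a *: A x + A y.
Proof.
move=> sA; apply: inner_inj => z.
by rewrite sA innerDZl -!sA -innerDZl.
Qed.
Lemma symD A x y : sym A -> A (x + y) = A x + A y.
Proof. by move=> sA; rewrite -[x in LHS]scale1r sym_linear // scale1r. Qed.
Lemma symB A x y : sym A -> A (x - y) = A x - A y.
Proof. by move=> sA; rewrite addrC -scaleN1r sym_linear // scaleN1r addrC. Qed.
Lemma sym0 A : sym A -> A 0 = 0.
Proof. by move=> sA; have := symB 0 0 sA; rewrite !subrr. Qed.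
Lemma symZ A a x : sym A -> A (a *: x) = a *: A x.
Proof. by move=> sA; rewrite -[a *: x]addr0 sym_linear // sym0 // addr0. Qed.

Lemma sym_rip A x y : sym A -> rp (A x) y = rp x (A y).
Proof. by move=> sA; rewrite /rip /= sA. Qed.

Definition tends (u : nat -> H) p := forall e : R, 0 < e ->
  exists N, forall n, (N <= n)%N -> nq (u n - p) < e.

(** A relation [u n . y = x . v n] between inner products is a closed condition
    on the pair [(u n, v n)], which is orthogonal to [(y, - x)]. *)
Lemma tends_rip (u v : nat -> H) p q x y : tends u p -> tends v q ->
  (forall n, rp (u n) y = rp x (v n)) -> rp p y = rp x q.
Proof.
move=> up vq uv.
pose L : set (H * H) := [set ab | rp ab.1 y = rp x ab.2].
have pq : adh (graph_form H H) L (p, q).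
  move=> e e0; have e2 : 0 < e / 2 by rewrite divr_gt0.
  have [N1 H1] := up _ e2; have [N2 H2] := vq _ e2.
  pose n := maxn N1 N2; exists (u n, v n); first exact: uv.
  have := H1 n (leq_maxl _ _); have := H2 n (leq_maxr _ _).
  rewrite -nsqN opprB -(nsqN _ (u n - p)) opprB nsqP /= => ? ?.
  by rewrite [e]splitr; exact: ltrD.
have := @adh_rip _ _ (graph_form H H) L (p, q) (y, - x) pq.
have E a b : rip (graph_form H H) (a, b) (y, - x) = rp a y - rp x b.
  by rewrite (ripC _ x b) /rip /= /pair_inner /= ReD innerNr ReN.
rewrite E => h; apply/eqP; rewrite -subr_eq0; apply/eqP; apply: h.
by move=> [a b] /= Lab; rewrite E Lab subrr.
Qed.

Lemma tends_inner (u v : nat -> H) p q x y : tends u p -> tends v q ->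
  (forall n, inner H (u n) y = inner H x (v n)) -> inner H p y = inner H x q.
Proof.
move=> up vq uv.
have h1 : rp p y = rp x q by apply: (tends_rip up vq) => n; rewrite /rip /= uv.
have h2 : rp p ('i *: y) = rp ('i^* *: x) q.
  by apply: (tends_rip up vq) => n; rewrite /rip /= innerZr innerZl uv.
move: h1 h2; rewrite /rip /= innerZr innerZl.
case: (inner H p y) => a b; case: (inner H x q) => a' b' /=.
rewrite !mul0r !sub0r !mulN1r !opprK => -> h; congr (_ +i* _).
by move: h; rewrite ?sub0r ?oppr0; lra.
Qed.

Definition nrm x : R := complex.Re `|x|.

Lemma nrmE x : `|x| = (nrm x)%:C.
Proof. by have [] := Re_inner_norm x. Qed.
Lemma nq_nrm x : nq x = nrm x ^+ 2.
Proof. by have [] := Re_inner_norm x. Qed.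
Lemma nrm_ge0 x : 0 <= nrm x.
Proof. by rewrite -ler0c -nrmE. Qed.
Lemma nrmD x y : nrm (x + y) <= nrm x + nrm y.
Proof. by rewrite -lecR rmorphD /= -!nrmE ler_normD. Qed.
Lemma nrmB x y : nrm (x - y) <= nrm x + nrm y.
Proof. by rewrite -lecR rmorphD /= -!nrmE ler_normB. Qed.
Lemma nrmZ (t : R) x : 0 <= t -> nrm (t%:C *: x) = t * nrm x.
Proof.
move=> t0; apply: (@complexI R).
by rewrite -nrmE normrZ rmorphM /= -nrmE ger0_norm // ler0c.
Qed.
Lemma nrm_le x y : (nrm x <= nrm y) = (nq x <= nq y).
Proof. by rewrite !nq_nrm ler_pXn2r // nnegrE nrm_ge0. Qed.

(** With [B = 1 - A], the identity [A B = A B A + B A B] writes [A - A^2] as a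
    sum of two positive operators, so [|A x|^2 <= (A x, x)]. *)
Lemma pos_contraction A x : sym A -> (forall x, 0 <= rp (A x) x) ->
  (forall x, rp (A x) x <= nq x) -> nrm (A x) <= nrm x.
Proof.
move=> sA pA cA; rewrite nrm_le.
have := pA (x - A x); have := cA (A x); have := cA x.
rewrite symB // !ripBl !ripBr (sym_rip (A x) x sA) !nsqE; lra.
Qed.

(** The fixed point [X] of the iteration satisfies [(1 - X)^2 = 1 - A]. *)
Fixpoint sqrt_iter A n x : H :=
  if n is m.+1 then (2^-1 : R)%:C *: (A x + sqrt_iter A m (sqrt_iter A m x)) else 0.

(** The same iteration for the scalar 1 in place of [A]; it dominates the
    operator iteration and its increments, and is increasing and bounded by 1. *)
Fixpoint sqrt_weight n : R := if n is m.+1 then 2^-1 * (1 + sqrt_weight m ^+ 2) else 0.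

Lemma sqrt_weight_ge0 n : 0 <= sqrt_weight n.
Proof. by case: n => //= n; rewrite mulr_ge0 // addr_ge0 // sqr_ge0. Qed.
Lemma sqrt_weight_le1 n : sqrt_weight n <= 1.
Proof.
elim: n => //= n IH; have := sqrt_weight_ge0 n => h.
have : sqrt_weight n ^+ 2 <= 1 by rewrite exprn_ile1.
lra.
Qed.
Lemma sqrt_weight_ndS n : sqrt_weight n <= sqrt_weight n.+1.
Proof. have := sqr_ge0 (1 - sqrt_weight n) => /=; lra. Qed.

Section Iteration.
Variable A : H -> H.
Hypothesis sA : sym A.
Hypothesis cA : forall x, nrm (A x) <= nrm x.

Lemma sqrt_iter_sym n : sym (sqrt_iter A n).
Proof.
elim: n => [|n IH] x y /=; first by rewrite inner0l inner0r.
rewrite innerZl innerZr; congr (_ * _).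
  by apply/eqP; rewrite eq_complex /= oppr0 !eqxx.
by rewrite innerDl innerDr sA !IH.
Qed.

Lemma sqrt_iter_comm C n x : sym C -> (forall x, A (C x) = C (A x)) ->
  sqrt_iter A n (C x) = C (sqrt_iter A n x).
Proof.
move=> sC AcC; elim: n x => [|n IH] x /=; first by rewrite sym0.
by rewrite (symZ _ _ sC) (symD _ _ sC) AcC !IH.
Qed.

Lemma sqrt_iter_bound n x : nrm (sqrt_iter A n x) <= sqrt_weight n * nrm x.
Proof.
elim: n x => [|n IH] x /=.
  by rewrite mul0r /nrm normr0.
rewrite nrmZ // -mulrA ler_wpM2l // mulrDl mul1r.
apply: le_trans (nrmD _ _) _; apply: lerD => //.
apply: le_trans (IH _) _; rewrite expr2 -mulrA.
by apply: ler_wpM2l => //; exact: sqrt_weight_ge0.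
Qed.

Lemma sqrt_iter_bound1 n x : nrm (sqrt_iter A n x) <= nrm x.
Proof.
apply: le_trans (sqrt_iter_bound n x) _.
by rewrite ler_piMl ?nrm_ge0 ?sqrt_weight_le1.
Qed.

(** Factor the increment as [X'^2 - X^2 = (X' - X) X' + X (X' - X)] and compare
    with the scalar iteration, in which the same factorization is an equality. *)
Lemma sqrt_iter_step n x :
  nrm (sqrt_iter A n.+1 x - sqrt_iter A n x) <=
  (sqrt_weight n.+1 - sqrt_weight n) * nrm x.
Proof.
elim: n x => [|n IH] x.
  rewrite /= subr0 addr0 expr0n /= addr0 mulr1 subr0 nrmZ //.
  by rewrite ler_wpM2l.
have -> : sqrt_iter A n.+2 x - sqrt_iter A n.+1 x = (2^-1 : R)%:C *:
   ((sqrt_iter A n.+1 (sqrt_iter A n.+1 x) - sqrt_iter A n (sqrt_iter A n.+1 x)) +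
     sqrt_iter A n (sqrt_iter A n.+1 x - sqrt_iter A n x)).
  rewrite [LHS]/= -/(sqrt_iter A n.+1) -scalerBr; congr (_ *: _).
  by rewrite opprD addrACA subrr add0r symB ?addrA ?subrK //; exact: sqrt_iter_sym.
rewrite nrmZ //.
have -> : sqrt_weight n.+2 - sqrt_weight n.+1 =
    2^-1 * ((sqrt_weight n.+1 - sqrt_weight n) * sqrt_weight n.+1 +
            sqrt_weight n * (sqrt_weight n.+1 - sqrt_weight n)).
  by rewrite [sqrt_weight n.+2]/= -/(sqrt_weight n.+1) {2}[sqrt_weight n.+1]/=; field.
rewrite -mulrA ler_wpM2l // mulrDl; apply: le_trans (nrmD _ _) _; apply: lerD.
  apply: le_trans (IH _) _; rewrite -mulrA ler_wpM2l //.
    by rewrite subr_ge0 sqrt_weight_ndS.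
  exact: sqrt_iter_bound.
apply: le_trans (sqrt_iter_bound _ _) _; rewrite -mulrA ler_wpM2l //.
exact: sqrt_weight_ge0.
Qed.

Lemma sqrt_iter_diff n k x :
  nrm (sqrt_iter A (k + n) x - sqrt_iter A n x) <=
  (sqrt_weight (k + n) - sqrt_weight n) * nrm x.
Proof.
elim: k => [|k IH]; first by rewrite !subrr mul0r /nrm normr0.
have -> : sqrt_iter A (k.+1 + n) x - sqrt_iter A n x =
  (sqrt_iter A (k + n).+1 x - sqrt_iter A (k + n) x) +
  (sqrt_iter A (k + n) x - sqrt_iter A n x).
  by rewrite addrA subrK.
apply: le_trans (nrmD _ _) _.
have := sqrt_iter_step (k + n) x; move: IH; rewrite addSn.
set a := nrm _; set b := nrm _.
move: (sqrt_weight _) (sqrt_weight _) (sqrt_weight _) => p q r; lra.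
Qed.

Lemma sqrt_weight_nd m n : (m <= n)%N -> sqrt_weight m <= sqrt_weight n.
Proof.
move=> /subnK <-; elim: (n - m)%N => // k IH.
by apply: le_trans IH _; exact: sqrt_weight_ndS.
Qed.

(** The increments are dominated by those of a bounded increasing sequence of
    numbers, so the iterates converge, even in operator norm. *)
Lemma sqrt_iter_cvg x : exists p, tends (sqrt_iter A ^~ x) p.
Proof.
apply: inner_complete => e e0.
have hs : has_sup [set r | exists n, r = sqrt_weight n].
  by split; [exists 0; exists 0%N | exists 1 => _ [n ->]; exact: sqrt_weight_le1].
(* Chosen so that d * (nrm x + 1) is half of the square root of e. *)
pose d := Num.sqrt e / (2 * (nrm x + 1)).
have x1 : 0 < 2 * (nrm x + 1) by rewrite mulr_gt0 // ltr_wpDl // nrm_ge0.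
have d0 : 0 < d by rewrite divr_gt0 // sqrtr_gt0.
have [_ [N ->] HN] := sup_adherent d0 hs; exists N.
have main n : (N <= n)%N -> nrm (sqrt_iter A n x - sqrt_iter A N x) < Num.sqrt e / 2.
  move=> Nn; have := sqrt_iter_diff N (n - N) x; rewrite subnK // => h.
  apply: le_lt_trans h _.
  have : sqrt_weight n <= sup [set r | exists n, r = sqrt_weight n].
    by apply: (ub_le_sup hs.2); exists n.
  move=> h1; have h2 : sqrt_weight n - sqrt_weight N < d by move: HN; lra.
  have -> : Num.sqrt e / 2 = d * (nrm x + 1).
    by rewrite /d; field; rewrite gt_eqF // ltr_wpDl // nrm_ge0.
  have := nrm_ge0 x; have := sqrt_weight_nd Nn; nra.
move=> m n Nm Nn.
rewrite -/(nq (sqrt_iter A m x - sqrt_iter A n x)) nq_nrm -[ltRHS]sqr_sqrtr ?ltW //.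
rewrite ltr_pXn2r ?nnegrE ?nrm_ge0 ?sqrtr_ge0 //.
have -> : sqrt_iter A m x - sqrt_iter A n x =
    (sqrt_iter A m x - sqrt_iter A N x) - (sqrt_iter A n x - sqrt_iter A N x).
  by rewrite opprB addrA subrK.
apply: le_lt_trans (nrmB _ _) _; rewrite [Num.sqrt e]splitr.
by apply: ltrD; exact: main.
Qed.

End Iteration.

Lemma nsqD_le x y : nq (x + y) <= 2 * nq x + 2 * nq y.
Proof. by have := nsq_ge0 (hilbert_form H) (x - y); rewrite nsqB nsqD; lra. Qed.

Lemma tends_unique (u : nat -> H) p q : tends u p -> tends u q -> p = q.
Proof.
move=> up uq; apply/eqP; rewrite -subr_eq0; apply/eqP; apply: nsq_eq0.
apply/eqP; rewrite eq_le nsq_ge0 andbT; apply/ler_addgt0Pr => e e0.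
rewrite add0r; have e4 : 0 < e / 4 by rewrite divr_gt0.
have [N1 H1] := up _ e4; have [N2 H2] := uq _ e4.
pose n := maxn N1 N2.
have -> : p - q = - (u n - p) + (u n - q) by rewrite opprB addrA subrK.
have := nsqD_le (- (u n - p)) (u n - q); rewrite nsqN.
have := H1 n (leq_maxl _ _); have := H2 n (leq_maxr _ _); lra.
Qed.

(** The limit X of the iteration for [Y = 1 - A] satisfies [2 X = Y + X^2], so
    [W = 1 - X] squares to [A]; [W] lies between 0 and 2 because X is a
    contraction.  The iterates are polynomials in [A], whence the commutation. *)
Theorem square_root A : sym A -> (forall x, 0 <= rp (A x) x) ->
  (forall x, rp (A x) x <= nq x) ->
  exists W, [/\ sym W, forall x, 0 <= rp (W x) x,
    forall x, rp (W x) x <= 2 * nq x, forall x, W (W x) = A x &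
    forall C, sym C -> (forall x, A (C x) = C (A x)) ->
      forall x, W (C x) = C (W x)].
Proof.
move=> sA pA A1.
pose Y x := x - A x.
have sY : sym Y by move=> x y; rewrite /Y innerBl innerBr sA.
have cY x : nrm (Y x) <= nrm x.
  apply: pos_contraction => // {}x; rewrite /Y ripBl.
    by rewrite subr_ge0; exact: A1.
  by rewrite lerBlDr lerDl.
have /choice [X HX] := sqrt_iter_cvg sY cY.
have sX : sym X.
  by move=> x y; apply: (tends_inner (HX x) (HX y)) => n; exact: sqrt_iter_sym.
have X1 x : nq (X x) <= nq x.
  suff : nrm (X x) <= nrm x by rewrite nrm_le.
  apply/ler_addgt0Pr => e e0; have [N HN] := HX x _ (exprn_gt0 2 e0).
  have := HN N (leqnn _); rewrite nq_nrm ltr_pXn2r ?nnegrE ?nrm_ge0 ?(ltW e0) // => h.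
  have -> : X x = sqrt_iter Y N x - (sqrt_iter Y N x - X x) by rewrite opprB addrC subrK.
  by apply: le_trans (nrmB _ _) _; apply: lerD (sqrt_iter_bound1 cY _ _) (ltW h).
have XX x : X x + X x = Y x + X (X x).
  have h1 : tends (fun n => sqrt_iter Y n.+1 x) (X x).
    by move=> e /(HX x) [N HN]; exists N => n Nn; apply: HN; rewrite leqW.
  suff h2 : tends (fun n => sqrt_iter Y n.+1 x) ((2^-1 : R)%:C *: (Y x + X (X x))).
    rewrite {1 2}(tends_unique h1 h2) -scalerDl -rmorphD /=.
    have -> : (2^-1 + 2^-1 : R) = 1 by field.
    exact: scale1r.
  move=> e e0; have [N1 H1] := HX x _ e0; have [N2 H2] := HX (X x) _ e0.
  exists (maxn N1 N2) => n; rewrite geq_max => /andP[/H1 {}H1 /H2 {}H2].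
  rewrite /= -scalerBr nsqZ opprD addrACA subrr add0r.
  have -> : sqrt_iter Y n (sqrt_iter Y n x) - X (X x) =
     sqrt_iter Y n (sqrt_iter Y n x - X x) + (sqrt_iter Y n (X x) - X (X x)).
    by rewrite (symB _ _ (sqrt_iter_sym sY n)) addrA subrK.
  have := nsqD_le (sqrt_iter Y n (sqrt_iter Y n x - X x)) (sqrt_iter Y n (X x) - X (X x)).
  have := sqrt_iter_bound1 cY n (sqrt_iter Y n x - X x); rewrite nrm_le.
  move: H1 H2; lra.
exists (fun x => x - X x); split.
- by move=> x y; rewrite innerBl innerBr sX.
- move=> x; have := nsq_ge0 (hilbert_form H) (x - X x); have := X1 x.
  rewrite nsqB ripBl (ripC _ (X x)) -nsqE; lra.
- move=> x; have := nsq_ge0 (hilbert_form H) (x + X x); have := X1 x.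
  rewrite nsqD ripBl (ripC _ (X x)) -nsqE; lra.
- move=> x; rewrite (symB _ _ sX).
  have h := XX x.
  have -> : A x = x - Y x by rewrite /Y opprB addrC subrK.
  have -> : Y x = X x + X x - X (X x) by rewrite h addrK.
  by rewrite !opprD !opprK !addrA.
- move=> C sC AcC x; rewrite [RHS](symB _ _ sC); congr (_ - _).
  apply: inner_inj => y; rewrite [RHS]sC [RHS]sX.
  apply: (tends_inner (HX (C x)) (HX (C y))) => n.
  rewrite (sqrt_iter_comm _ _ sC); first by rewrite sC (sqrt_iter_sym sY).
  by move=> {}x; rewrite /Y (symB _ _ sC) AcC.
Qed.
End SquareRoot.

Section PositiveOperators.
Context {R : realType} {H : hilbertType R}.
Implicit Types (A C : H -> H) (x y : H).

Notation rp := (rip (hilbert_form H)).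
Notation nq := (nsq (hilbert_form H)).

Definition pos A := forall x, 0 <= rp (A x) x.

Lemma sym_inner_ge0 A x : sym A -> 0 <= rp (A x) x -> 0 <= inner H (A x) x.
Proof.
move=> sA; rewrite lecE /= /rip /= => ->; rewrite andbT.
have := innerC (A x) x; rewrite -sA; case: (inner H (A x) x) => a b /= [h].
by apply/eqP; move: h; lra.
Qed.

(** Cauchy-Schwarz for the semidefinite form [(A x, y)]. *)
Lemma pos_eq0 A y : sym A -> pos A -> rp (A y) y = 0 -> A y = 0.
Proof.
move=> sA pA Ay; apply: nsq_eq0; rewrite nsqE.
apply/eqP; rewrite -sqrf_eq0; apply/eqP/le_anti; rewrite sqr_ge0 andbT.
rewrite -(mul0r (rp (A (A y)) (A y))).
apply: quadratic_discr => [|t]; first exact: pA.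
have := pA (y - t%:C *: A y); rewrite (symB _ _ sA) (symZ _ _ sA).
rewrite !ripBl !ripBr !ripZl !ripZr Ay (sym_rip (A y) y sA).
set a := rp _ _; set b := rp _ _; move=> h; apply: le_trans h _.
by rewrite le_eqVlt; apply/orP; left; apply/eqP; ring.
Qed.

(** For [y = A x - C x] one has [A y + C y = A^2 x - C^2 x = 0]; both terms are
    positive on [y], so [A y = C y = 0], and then
    [|y|^2 = (x, A y - C y) = 0]. *)
Lemma square_root_unique A C : sym A -> sym C -> pos A -> pos C ->
  (forall x, A (A x) = C (C x)) -> (forall x, A (C x) = C (A x)) -> A =1 C.
Proof.
move=> sA sC pA pC AACC AcC x; pose y := A x - C x.
have yy : A y + C y = 0.
  by rewrite (symB _ _ sA) (symB _ _ sC) AACC AcC addrC addrA subrK subrr.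
have Ay : rp (A y) y = 0.
  have := pA y; have := pC y; have : rp (A y + C y) y = 0.
    by rewrite yy /rip /= inner0l.
  rewrite ripDl; lra.
have A0 := pos_eq0 sA pA Ay.
have C0 : C y = 0 by rewrite A0 add0r in yy.
apply/eqP; rewrite -subr_eq0; apply/eqP; apply: inner_eq0.
by rewrite -/y {1}/y innerBl sA sC A0 C0 subrr.
Qed.

(** The product of the commuting positive roots P and Q is positive because a
    root W of [P / 2] commutes with Q, so that [P Q = 2 W Q W].  The factor
    [1 / 2] is there because [P <= 2] is the bound that [square_root] gives. *)
Lemma root_pair A : sym A -> pos A -> (forall x, rp (A x) x <= nq x) ->
  exists P Q, [/\ [/\ sym P, pos P, sym Q & pos Q],
    forall x, P (P x) = A x, forall x, Q (Q x) = x - A x,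
    (forall x, P (Q x) = Q (P x)) /\ pos (P \o Q) &
    forall C, sym C -> (forall x, A (C x) = C (A x)) ->
     (forall x, P (C x) = C (P x)) /\ (forall x, Q (C x) = C (Q x))].
Proof.
move=> sA pA A1.
have [P [sP pP P2 PP cP]] := square_root sA pA A1.
pose B x := x - A x.
have sB : sym B by move=> x y; rewrite innerBl innerBr sA.
have [|x|Q [sQ pQ _ QQ cQ]] := @square_root _ _ B sB.
- by move=> x; rewrite ripBl subr_ge0; exact: A1.
- by rewrite ripBl lerBlDr lerDl; exact: pA.
have cQA C : sym C -> (forall x, A (C x) = C (A x)) -> forall x, Q (C x) = C (Q x).
  by move=> sC AcC; apply: cQ => // x; rewrite /B AcC (symB _ _ sC).
have AQ x : A (Q x) = Q (A x) by rewrite (cQA A sA).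
have PQ : forall x, P (Q x) = Q (P x) by exact: cP.
exists P, Q; split=> //; last by move=> C sC AcC; split; [exact: cP | exact: cQA].
split=> // x /=.
(* Halving brings P below the identity, as square_root requires. *)
pose P' x := (2^-1 : R)%:C *: P x.
have sP' : sym P'.
  move=> u v; rewrite innerZl innerZr sP; congr (_ * _).
  by apply/eqP; rewrite eq_complex /= oppr0 !eqxx.
have [| |W [sW _ _ WW cW]] := @square_root _ _ P' sP'.
- by move=> u; rewrite ripZl mulr_ge0 //; exact: pP.
- by move=> u; rewrite ripZl; have := P2 u; lra.
have QW : W (Q x) = Q (W x).
  by apply: cW => // u; rewrite /P' PQ (symZ _ _ sQ).
have -> : rp (P (Q x)) x = 2 * rp (Q (W x)) (W x).
  rewrite -QW -(sym_rip _ x sW) WW ripZl mulrA divff ?mul1r //.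
by rewrite mulr_ge0 //; exact: pQ.
Qed.

End PositiveOperators.

(** * The square root of a nonnegative selfadjoint relation *)

Section RelationRoot.
Context {R : realType} {H : hilbertType R}.
Implicit Types (x y : H).

Notation rp := (rip (hilbert_form H)).
Notation nq := (nsq (hilbert_form H)).

Lemma symmetric_inner (A : set (H * H)) p q : symmetric_relation A ->
  A p -> A q -> inner H p.2 q.1 = inner H p.1 q.2.
Proof. by move=> sA Ap Aq; exact: (sA _ Ap _ Aq). Qed.

Lemma perp_dperp (D : set H) x : perp D x -> perp (perp D) x -> x = 0.
Proof. by move=> Dx DDx; apply: inner_eq0; exact: DDx. Qed.

Variables (A : set (H * H)) (res : H -> H).
Hypothesis saA : adj A = A.
Hypothesis nnA : nonneg A.
Hypothesis HR : forall h, A (res h, h - res h).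

Let sA : linear_subspace A. Proof. by rewrite -saA; exact: adj_subspace. Qed.
Let symA : symmetric_relation A. Proof. by rewrite /symmetric_relation saA. Qed.

Lemma res_eq f g : A (f, g) -> res (f + g) = f.
Proof.
move=> Afg; apply: (resolvent_unique sA nnA (HR (f + g))).
by rewrite addrC addKr.
Qed.

(** Split [u] as [res u + (u - res u)] and use the symmetry of [A] on the two
    pairs [(res h, h - res h)] and [(res u, u - res u)]. *)
Lemma res_sym : sym res.
Proof.
move=> h u; rewrite -{1}(subrK (res u) u) innerDr.
rewrite -(symmetric_inner symA (HR h) (HR u)) /= -innerDl.
by rewrite subrK.
Qed.

Lemma res_inner_ge0 h : 0 <= rp (res h) (h - res h).
Proof.
by have := nnA (HR h); rewrite lecE /= => /andP[_]; rewrite ripC.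
Qed.

Lemma res_pos : pos res.
Proof.
move=> h; have := res_inner_ge0 h; have := nsq_ge0 (hilbert_form H) (res h).
rewrite ripBr nsqE; lra.
Qed.

Lemma res_le h : rp (res h) h <= nq h.
Proof.
have := res_inner_ge0 h; have := nsq_ge0 (hilbert_form H) (h - res h).
rewrite nsqB ripBr (ripC _ h) nsqE; lra.
Qed.

Notation N := (Defs.mul A).
Notation M := (perp N).

Lemma mul_selfadjoint : N = perp A.`1. Proof. by rewrite -{1}saA mul_adj. Qed.

Lemma ker_res k : N k <-> res k = 0.
Proof.
split=> [Nk|Rk]; first by rewrite -[k]add0r; exact: (res_eq Nk).
by have := HR k; rewrite Rk subr0.
Qed.

Lemma closure_dom : closure A.`1 = M.
Proof. by rewrite mul_selfadjoint; apply: closure_perp; exact: dom_subspace. Qed.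

Lemma res_dom h : M (res h).
Proof. by move=> n /ker_res Rn; rewrite res_sym Rn inner0r. Qed.

Lemma N_M_eq0 x : N x -> M x -> x = 0.
Proof. by rewrite mul_selfadjoint; exact: perp_dperp. Qed.

Definition perp_part h := h - orthproj N h.

Lemma perp_part_M h : M (perp_part h).
Proof.
by rewrite /perp_part mul_selfadjoint; have [] := orthproj_perp (dom_subspace sA) h.
Qed.

Lemma perp_part_N h : N (h - perp_part h).
Proof.
rewrite /perp_part opprB addrC subrK.
by rewrite mul_selfadjoint; have [] := orthproj_perp (dom_subspace sA) h.
Qed.

Lemma res_perp_part h : res (perp_part h) = res h.
Proof.
have /ker_res := perp_part_N h; rewrite (symB _ _ res_sym) => /eqP.
by rewrite subr_eq0 => /eqP.
Qed.

Lemma M_sub x y : M x -> M y -> M (x - y).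
Proof. by move=> Mx My; exact: (subspaceB (perp_subspace N) Mx My). Qed.
Lemma M_add x y : M x -> M y -> M (x + y).
Proof. by move=> Mx My; exact: (subspaceD (perp_subspace N) Mx My). Qed.
Lemma N_sub x y : N x -> N y -> N (x - y).
Proof. by rewrite mul_selfadjoint => Nx Ny; exact: (subspaceB (perp_subspace _) Nx Ny). Qed.

Lemma perp_part_eq h k : N (h - k) -> M k -> perp_part h = k.
Proof.
move=> Nhk Mk; apply/eqP; rewrite -subr_eq0; apply/eqP; apply: N_M_eq0.
  have -> : perp_part h - k = (h - k) - (h - perp_part h) by rewrite opprB [RHS]addrC addrA subrK.
  by apply: N_sub => //; exact: perp_part_N.
by apply: M_sub => //; exact: perp_part_M.
Qed.

Lemma perp_part_id h : M h -> perp_part h = h.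
Proof.
by move=> Mh; apply: perp_part_eq => //; rewrite subrr mul_selfadjoint; case: (perp_subspace A.`1).
Qed.

Lemma inner_perp_part x h : M x -> inner H x h = inner H x (perp_part h).
Proof.
by move=> Mx; rewrite -{1}(subrK (perp_part h) h) innerDr (Mx _ (perp_part_N h)) add0r.
Qed.

(** The regular part is parametrized by the resolvent restricted to the closure
    of the domain: the component of [h] in the multivalued part is killed both by
    the resolvent and by the projection that defines [reg]. *)
Lemma reg_selfadjoint : reg A = [set p | exists2 h, M h & p = (res h, h - res h)].
Proof.
rewrite /reg saA saA; apply/seteqP; split=> -[f g] /=.
  move=> [k Afk ->]; exists (perp_part (f + k)); first exact: perp_part_M.
  rewrite res_perp_part (res_eq Afk); congr (_, _).
  rewrite -/(perp_part k); apply: perp_part_eq; last first.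
    by apply: M_sub; [exact: perp_part_M | rewrite -(res_eq Afk); exact: res_dom].
  rewrite opprB addrA [k + f]addrC; exact: perp_part_N.
move=> [h Mh [-> ->]]; exists (h - res h) => //.
rewrite -/(perp_part _) perp_part_id //; apply: M_sub => //; exact: res_dom.
Qed.

Section Root.
Variables P Q : H -> H.
Hypothesis (sP : sym P) (pP : pos P) (sQ : sym Q) (pQ : pos Q).
Hypothesis PP : forall x, P (P x) = res x.
Hypothesis QQ : forall x, Q (Q x) = x - res x.
Hypothesis PQ : forall x, P (Q x) = Q (P x).
Hypothesis pPQ : pos (P \o Q).
Hypothesis comm : forall C, sym C -> (forall x, res (C x) = C (res x)) ->
  (forall x, P (C x) = C (P x)) /\ (forall x, Q (C x) = C (Q x)).

(** Since [P^2] is the resolvent and [Q^2] its complement, this is formally the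
    graph of [Q P^-1], the square root of [(1 - P^2) P^-2]. *)
Definition rootrel : set (H * H) := [set p | exists2 x, M x & p = (P x, Q x)].

Lemma P_N n : N n -> P n = 0.
Proof.
move=> /ker_res Rn; apply: inner_eq0.
by rewrite sP PP Rn inner0r.
Qed.

Lemma Q_N n : N n -> Q n = n.
Proof.
move=> /ker_res Rn; pose y := n - Q n.
have yy : y + Q y = 0.
  by rewrite /y (symB _ _ sQ) QQ Rn subr0 addrA subrK subrr.
suff : y = 0 by move=> /eqP; rewrite subr_eq0 => /eqP.
apply: nsq_eq0.
have : rp (y + Q y) y = 0 by rewrite yy /rip /= inner0l.
have := pQ y; have := nsq_ge0 (hilbert_form H) y; rewrite ripDl nsqE; lra.
Qed.

Lemma P_M x : M (P x).
Proof. by move=> n Nn; rewrite sP P_N // inner0r. Qed.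

Lemma Q_M x : M x -> M (Q x).
Proof. by move=> Mx n Nn; rewrite sQ Q_N // Mx. Qed.

Lemma rootrel_M : rootrel `<=` M `*` M.
Proof. by move=> _ [x Mx ->]; split; [exact: P_M | exact: Q_M]. Qed.

(** The parameter is [x = P y + Q y'], because [P^2 + Q^2 = 1]. *)
Lemma rootrel_mem y y' : M y -> M y' -> P y' = Q y -> rootrel (y, y').
Proof.
move=> My My' PQy; exists (P y + Q y').
  by apply: M_add; [exact: P_M | exact: Q_M].
rewrite (symD _ _ sP) (symD _ _ sQ) PP QQ PQ PQy QQ -PQ -PQy PP.
by rewrite addrC subrK addrC subrK.
Qed.

(** For a pair of the adjoint, [P y' - Q y] is orthogonal to the closure of the
    domain, to which it belongs; so it vanishes and [rootrel_mem] applies. *)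
Lemma rootrel_sa : selfadjoint_in M rootrel.
Proof.
split; last exact: rootrel_M.
apply/seteqP; split=> [p Sp|[y y'] [ady [My My']]].
  split; last exact: rootrel_M.
  case: Sp => x Mx -> _ [x' Mx' ->] /=.
  by rewrite sQ -PQ sP.
apply: rootrel_mem => //; apply/eqP; rewrite -subr_eq0; apply/eqP.
apply: inner_eq0.
have MD : M (P y' - Q y) by apply: M_sub; [exact: P_M | exact: Q_M].
rewrite {1}innerBl sP sQ.
have := ady (P (P y' - Q y), Q (P y' - Q y)).
by move=> /(_ (ex_intro2 _ _ _ MD erefl)) /= ->; rewrite subrr.
Qed.

Lemma rootrel_nonneg : nonneg rootrel.
Proof.
move=> _ [x Mx ->] /=; rewrite -sP.
apply: (@sym_inner_ge0 _ _ (P \o Q)); last exact: pPQ.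
by move=> u v /=; rewrite sP sQ PQ.
Qed.

(** A chain [(P x, Q x)], [(P x2, Q x2)] with [Q x = P x2] comes from the single
    parameter [P x + Q x2], since [P^2 + Q^2 = 1]. *)
Lemma rootrel_sq : (rootrel \; rootrel)%relation = reg A.
Proof.
rewrite reg_selfadjoint; apply/seteqP; split=> [[f g] [z [x Mx [-> ->]] [x2 Mx2 [Qx ->]]] | ].
  exists (P x + Q x2); first by apply: M_add; [exact: P_M | exact: Q_M].
  have Pw : P (P x + Q x2) = x.
    by rewrite (symD _ _ sP) PP PQ -Qx QQ addrC subrK.
  have Qw : Q (P x + Q x2) = x2.
    by rewrite (symD _ _ sQ) QQ -PQ Qx PP addrC subrK.
  by rewrite -QQ -PP Pw Qw.
move=> _ [h Mh ->]; exists (P (Q h)).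
  by exists (P h); [exact: P_M | rewrite /= PP PQ].
by exists (Q h); [exact: Q_M | rewrite /= QQ].
Qed.

(** The intermediate element [G h] of the chain in [S \; S] over [h] defines a
    positive operator that commutes with the resolvent J and squares to
    [J (1 - J)]; so [G = P Q].  Symmetry of [S] against the pairs [(J h, P Q h)]
    then gives [P (P y' - Q y) = 0] for every pair of [S], hence
    [S] is contained in [rootrel], and both are selfadjoint. *)
Lemma rootrel_unique (S : set (H * H)) : selfadjoint_in M S -> nonneg S ->
  (S \; S)%relation = reg A -> S = rootrel.
Proof.
move=> [adS SM] nnS SS.
have symS : symmetric_relation S by rewrite /symmetric_relation {1}adS => p [].
have subS : linear_subspace S.
  rewrite adS; have [a0 aS] := adj_subspace S.
  have [m0 mS] := perp_subspace N.
  split=> [|a p q [ap [p1 p2]] [aq [q1 q2]]]; first by split.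
  by split; [exact: aS | split; exact: mS].
have /choice [G HG] h : exists g, S (res h, g) /\ S (g, perp_part h - res h).
  have : reg A (res h, perp_part h - res h).
    by rewrite reg_selfadjoint; exists (perp_part h); [exact: perp_part_M | rewrite res_perp_part].
  by rewrite -SS => -[g ? ?]; exists g.
have opS k : S (0, k) -> k = 0.
  move=> Sk; have [_ Mk] := SM _ Sk; apply: N_M_eq0 => //.
  apply/ker_res; apply: inner_inj => h; rewrite inner0l res_sym.
  have [Sh _] := HG h.
  by rewrite (symmetric_inner symS Sk Sh) /= inner0l.
have fS f k k' : S (f, k) -> S (f, k') -> k = k'.
  move=> Sk Sk'; apply/eqP; rewrite -subr_eq0; apply/eqP; apply: opS.
  by have := subspaceB subS Sk Sk'; rewrite /GRing.add /= /add_pair /= subrr.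
have GM h : M (G h) by have [/SM[]] := HG h.
have sG : sym G.
  move=> h u; have [Sh1 Sh2] := HG h; have [Su1 Su2] := HG u.
  rewrite (inner_perp_part _ (GM h)) -(subrK (res u) (perp_part u)) innerDr.
  rewrite -(symmetric_inner symS Sh2 Su2) /= (symmetric_inner symS Sh1 Su1) /=.
  rewrite -innerDl subrK innerC -inner_perp_part //.
  by rewrite -innerC.
have pG : pos G.
  move=> h; have [Sh1 Sh2] := HG h.
  have := nnS _ Sh1; have := nnS _ Sh2; rewrite !lecE /= => /andP[_ h2] /andP[_ h1].
  rewrite /rip /= (inner_perp_part _ (GM h)) -(subrK (res h) (perp_part h)) innerDr ReD.
  by apply: addr_ge0 => //; rewrite -/(rip (hilbert_form H) _ _) ripC.
have RG h : res (G h) = G (res h).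
  have [Sh1 _] := HG h; have [Sr1 Sr2] := HG (res h).
  have : reg A (G (res h), G h - G (res h)).
    rewrite -SS; exists (perp_part (res h) - res (res h)) => //=.
    rewrite perp_part_id; last exact: res_dom.
    exact: (subspaceB subS Sh1 Sr1).
  rewrite reg_selfadjoint => -[h' _ [e1 e2]].
  by rewrite e1; congr (res _); rewrite -(subrK (G (res h)) (G h)) e2 e1 subrK.
have GG h : G (G h) = res h - res (res h).
  have [Sg _] := HG (G h); have [_ Sr] := HG (res h).
  by rewrite RG in Sg; rewrite (fS _ _ _ Sg Sr) perp_part_id //; exact: res_dom.
have [PG QG] := comm sG RG.
have GPQ : G =1 P \o Q.
  apply: square_root_unique => //.
  - by move=> u v /=; rewrite sP sQ PQ.
  - by move=> x /=; rewrite GG -PQ PP QQ (symB _ _ res_sym).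
  - by move=> x /=; rewrite QG PG.
have SR : S `<=` rootrel.
  move=> [y y'] Sy; have [My My'] := SM _ Sy.
  apply: rootrel_mem => //; apply/eqP; rewrite -subr_eq0; apply/eqP.
  apply: N_M_eq0; last by apply: M_sub; [exact: P_M | exact: Q_M].
  apply/ker_res; rewrite -PP.
  suff -> : P (P y' - Q y) = 0 by exact: sym0.
  apply: inner_inj => h; rewrite inner0l sP innerBl sP PP sQ.
  have [Sh _] := HG h; rewrite (symmetric_inner symS Sy Sh) /=.
  by rewrite GPQ /= PQ subrr.
apply/seteqP; split=> //; rewrite adS.
have [-> _] := rootrel_sa; move=> p [ap Mp]; split=> //.
exact: (adjS SR).
Qed.

Lemma sqrt_regE : sqrt_reg A = rootrel.
Proof.
rewrite /sqrt_reg /sqrt_in closure_dom; apply: xget_unique => [|S [[]]].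
  split; last exact: rootrel_sq.
  by split; [exact: rootrel_sa | exact: rootrel_nonneg].
exact: rootrel_unique.
Qed.

End Root.
End RelationRoot.

(** * Partial isometries *)

Section PartialIsometry.
Context {R : realType}.
Implicit Types H K : hilbertType R.

Lemma nsq_inner_le H K (x : H) (y : K) :
  (`|x| <= `|y|) = (nsq (hilbert_form H) x <= nsq (hilbert_form K) y).
Proof. exact: inner_norm_le. Qed.

Definition isometric H K (L : set (H * K)) :=
  forall p q, L p -> L q -> inner H p.1 q.1 = inner K p.2 q.2.

(** Equality of inner products is orthogonality to [(q.1, - q.2)], which passes
    to the closure in each variable. *)
Lemma isometric_adjadj H K (L : set (H * K)) : linear_subspace L ->
  isometric L -> isometric (adj (adj L)).
Proof.
move=> sL iL.
have step p q : adj (adj L) p -> L q -> inner H p.1 q.1 = inner K p.2 q.2.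
  move=> /(adjadj_adh sL) Lp Lq.
  have := @adh_perp _ _ _ _ _ (q.1, - q.2) Lp.
  rewrite /= /pair_inner /= innerNr => h; apply/eqP; rewrite -subr_eq0; apply/eqP.
  by apply: h => u Lu; rewrite innerNr (iL _ _ Lu Lq) subrr.
move=> p q Lp /(adjadj_adh sL) Lq.
rewrite innerC [RHS]innerC; congr (_^*).
have := @adh_perp _ _ _ _ _ (p.1, - p.2) Lq.
rewrite /= /pair_inner /= innerNr => h; apply/eqP; rewrite -subr_eq0; apply/eqP.
by apply: h => u Lu; rewrite innerNr (innerC p.1) (innerC p.2) (step _ _ Lp Lu) subrr.
Qed.

Lemma contraction_continuous H K (U : {linear K -> H}) :
  (forall k, nsq (hilbert_form H) (U k) <= nsq (hilbert_form K) k) -> continuous U.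
Proof.
move=> cU x; apply/cvgrPdist_lt => e e0.
have : nbhs x (ball x e) by exact: nbhsx_ballx.
apply: filterS => y; rewrite -ball_normE /ball_ /= => xy.
rewrite -raddfB; apply: le_lt_trans xy.
by rewrite nsq_inner_le; exact: cU.
Qed.

(** Let G be the closure of [L] and [(h, p)] the projection of [(0, 2 k)] onto G.
    Testing against a pair [(s, b)] of G and using [(h, s) = (p, b)] gives
    [(2 k - 2 p, b) = 0], so [p] is the projection of [k] on the range of G and
    [h] is the value wanted at [k].  This avoids completing the range separately. *)
Lemma isometric_extension H K (L : set (H * K)) : linear_subspace L ->
  isometric L ->
  exists U : {linear K -> H}, [/\ partial_isometry U,
    forall k, nsq (hilbert_form H) (U k) <= nsq (hilbert_form K) k &
    forall p, L p -> U p.2 = p.1].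
Proof.
move=> sL /(isometric_adjadj sL).
have LL := @sub_adjadj _ _ _ L; move: LL.
move: (adj_subspace (adj L)).
have : adh (graph_form H K) (adj (adj L)) `<=` adj (adj L) by exact: adh_adj.
move: (adj (adj L)) => G clG sG LG iG.
pose spec k (p : H * K) := G p /\ forall q, G q -> inner K (k - p.2) q.2 = 0.
have /choice [V HV] k : exists p, spec k p.
  (* The factor 2 compensates for the two equal contributions (h, s) and (p, b). *)
  have [p /clG Gp zp] := projection (graph_form H K) (0, k + k) sG.
  exists p; split=> // q Gq; have := zp q Gq.
  rewrite /= /pair_inner /= sub0r innerNl (iG _ _ Gp Gq) innerBl innerDl => h.
  rewrite innerBl; have {h} : 2 * (inner K k q.2 - inner K p.2 q.2) = 0.
    by rewrite -h; ring.
  by move/eqP; rewrite mulf_eq0 pnatr_eq0 /= => /eqP.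
have specU k p p' : spec k p -> spec k p' -> p = p'.
  move=> [Gp kp] [Gp' kp'].
  have Gd := subspaceB sG Gp Gp'.
  have d2 : p.2 - p'.2 = 0.
    apply: inner_eq0.
    have -> : inner K (p.2 - p'.2) (p.2 - p'.2) =
      inner K (k - p'.2) (p - p').2 - inner K (k - p.2) (p - p').2.
      rewrite -innerBl; congr (inner K _ _).
      by rewrite opprB [RHS]addrC addrA subrK.
    by rewrite kp // kp' // subrr.
  have d1 : p.1 - p'.1 = 0.
    by apply: inner_eq0; have := iG _ _ Gd Gd; rewrite /= d2 inner0l.
  apply/eqP; rewrite -subr_eq0; apply/eqP.
  by rewrite [p - p']surjective_pairing /= d1 d2.
have spec_lin a k l p q : spec k p -> spec l q -> spec (a *: k + l) (a *: p + q).
  move=> [Gp kp] [Gq lq]; split=> [|r Gr]; first exact: (sG.2).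
  have -> : a *: k + l - (a *: p + q).2 = a *: (k - p.2) + (l - q.2).
    by rewrite /= scalerBr opprD addrACA.
  by rewrite innerDZl kp // lq // mulr0 addr0.
have linU : linear (fun k => (V k).1).
  by move=> a k l; rewrite (specU _ _ _ (HV (a *: k + l)) (spec_lin a _ _ _ _ (HV k) (HV l))).
pose U : {linear K -> H} := HB.pack (fun k => (V k).1)
  (GRing.isLinear.Build _ _ _ _ (fun k => (V k).1) linU).
have UV k p : spec k p -> U k = p.1 by move=> /(specU _ _ _ (HV k)) <-.
have decomp k : nsq (hilbert_form K) k =
    nsq (hilbert_form K) (k - (V k).2) + nsq (hilbert_form H) (U k).
  have [Gp kp] := HV k.
  have -> : nsq (hilbert_form H) (U k) = nsq (hilbert_form K) (V k).2.
    by rewrite /nsq /= -(iG _ _ Gp Gp).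
  have r0 : rip (hilbert_form K) (k - (V k).2) (V k).2 = 0 by rewrite /rip /= (kp _ Gp).
  have := nsqD (hilbert_form K) (k - (V k).2) (V k).2.
  by rewrite r0 mulr0 addr0 subrK.
have cU k : nsq (hilbert_form H) (U k) <= nsq (hilbert_form K) k.
  by rewrite [leRHS]decomp lerDr nsq_ge0.
exists U; split=> //; last first.
  move=> p Lp; apply: UV; split=> [|q _]; first exact: LG.
  by rewrite subrr inner0l.
split; first exact: contraction_continuous.
move=> k kU; have [Gp kp] := HV k.
have Ukp : U (k - (V k).2) = 0.
  apply: (UV _ 0); split=> [|q Gq]; first by case: sG.
  by rewrite subr0 kp.
have kk : k - (V k).2 = 0.
  by apply: inner_eq0; rewrite {1}innerBl kU // [X in _ - X]inner_eq0C ?subrr // kp.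
apply/eqP; rewrite eq_le !nsq_inner_le; apply/andP; split; first exact: cU.
by rewrite decomp kk [X in X + _]form_self_eq0 ?add0r //= inner0l.
Qed.

Section Structure.
Variables (H K : hilbertType R) (U : {linear K -> H}).
Hypothesis piU : partial_isometry U.

Definition kerU : set K := [set k | U k = 0].

Lemma kerU_subspace : linear_subspace kerU.
Proof.
by split=> [|a u v uU vU]; rewrite /kerU /= ?raddf0 // linearP uU vU scaler0 addr0.
Qed.

(** The kernel is closed by continuity, hence a double orthogonal complement. *)
Lemma kerU_decomp k : exists2 k1, perp kerU k1 & U (k - k1) = 0.
Proof.
have cK : closed kerU.
  have [cU _] := piU.
  have : closed (U @^-1` [set 0]).
    apply: closed_comp => [x _|]; first exact: cU.
    apply: accessible_closed_set1; apply: hausdorff_accessible; exact: norm_hausdorff.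
  by [].
have EK : kerU = perp (perp kerU).
  by rewrite -closure_perp; [exact/closure_id | exact: kerU_subspace].
have [n] := perp_decomp (perp_subspace kerU) k.
rewrite -EK => Kn kn; exists (k - n) => //.
by rewrite opprB addrCA subrr addr0.
Qed.

Lemma piU_nsq x : perp kerU x -> nsq (hilbert_form H) (U x) = nsq (hilbert_form K) x.
Proof.
move=> /piU.2 Ux; rewrite /nsq /= -!inner_norm.
by congr (complex.Re (_ ^+ 2)).
Qed.

(** Polarization of [piU_nsq]; the factor ['i] supplies the imaginary part. *)
Lemma piU_inner x y : perp kerU x -> perp kerU y ->
  inner H (U x) (U y) = inner K x y.
Proof.
have rp x' y' : perp kerU x' -> perp kerU y' ->
    rip (hilbert_form H) (U x') (U y') = rip (hilbert_form K) x' y'.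
  move=> Px Py.
  have := piU_nsq (subspaceD (perp_subspace kerU) Px Py).
  rewrite raddfD !nsqD !piU_nsq //; lra.
move=> Px Py; apply/eqP; rewrite -subr_eq0; apply/eqP.
have h1 := rp _ _ Px Py.
have h2 := rp _ _ (subspaceZ 'i (perp_subspace kerU) Px) Py.
move: h1 h2; rewrite linearZ !ripI /rip /=.
case: (inner H _ _) => a b; case: (inner K _ _) => a' b' /= -> h.
by apply/eqP; rewrite eq_complex /= subrr eqxx /= -subr_eq0; apply/eqP; move: h; lra.
Qed.

Lemma piU_split k : exists k1, [/\ perp kerU k1,
  forall l, inner H (U k) (U l) = inner K k1 l &
  nsq (hilbert_form K) k = nsq (hilbert_form K) (k - k1) + nsq (hilbert_form H) (U k)].
Proof.
have [k1 Pk1 Uk] := kerU_decomp k; exists k1.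
have Ukk : U k = U k1 by move: Uk; rewrite raddfB => /eqP; rewrite subr_eq0 => /eqP.
split=> //.
  move=> l; have [l1 Pl1 Ul] := kerU_decomp l.
  have Ull : U l = U l1 by move: Ul; rewrite raddfB => /eqP; rewrite subr_eq0 => /eqP.
  by rewrite Ukk Ull piU_inner // -[in RHS](subrK l1 l) innerDr (Pk1 _ Ul) add0r.
have r0 : rip (hilbert_form K) (k - k1) k1 = 0 by rewrite ripC /rip /= (Pk1 _ Uk).
rewrite Ukk piU_nsq //; have := nsqD (hilbert_form K) (k - k1) k1.
by rewrite r0 mulr0 addr0 subrK.
Qed.

Lemma piU_contraction k : nsq (hilbert_form H) (U k) <= nsq (hilbert_form K) k.
Proof. by have [k1 [_ _ ->]] := piU_split k; rewrite lerDr nsq_ge0. Qed.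

Lemma adj_graphP s k :
  adj (graph U) (s, k) <-> forall x, inner K k x = inner H s (U x).
Proof.
split=> [h x|h [x y]]; first exact: (h (x, U x)).
by rewrite /graph /= => ->.
Qed.

Lemma adj_graph_fun s k k' :
  adj (graph U) (s, k) -> adj (graph U) (s, k') -> k = k'.
Proof.
by move=> /adj_graphP h /adj_graphP h'; apply: inner_inj => x; rewrite h h'.
Qed.

(** Equality of norms forces [k] into the initial space of [U], on which
    [adj (graph U)] inverts [U]. *)
Lemma adj_graph_isometric k : nsq (hilbert_form H) (U k) = nsq (hilbert_form K) k ->
  adj (graph U) (U k, k).
Proof.
have [k1 [Pk1 Uk ->]] := piU_split k => h.
have /nsq_eq0/eqP : nsq (hilbert_form K) (k - k1) = 0 by move: h; lra.
rewrite subr_eq0 => /eqP kk1.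
by apply/adj_graphP => x; rewrite Uk {1}kk1.
Qed.

(** Expand [|U k - s|^2]: the cross term is [(s, U k) = |k|^2] and [U] is a
    contraction. *)
Lemma adj_graph_inv s k : adj (graph U) (s, k) ->
  nsq (hilbert_form K) k = nsq (hilbert_form H) s -> U k = s.
Proof.
move=> /adj_graphP sk ks.
apply/eqP; rewrite -subr_eq0; apply/eqP; apply: nsq_eq0.
apply/eqP; rewrite eq_le nsq_ge0 andbT.
rewrite nsqB -ks (ripC _ _ s) /rip /= -sk.
have := piU_contraction k; rewrite /nsq /=; lra.
Qed.

(** When [S] and [B] have the same domain and [|S f| = |B f|] there, the values
    of [B] lie in the initial space of [U] as soon as [S = U B], and those of [S]
    in its final space as soon as [B] is the adjoint of [U] applied to [S]. *)
Lemma partial_isometry_factor (S : set (H * H)) (B : set (H * K)) :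
  (forall f s s', S (f, s) -> S (f, s') -> s = s') ->
  (forall f k k', B (f, k) -> B (f, k') -> k = k') ->
  (forall f s, S (f, s) ->
    exists2 k, B (f, k) & nsq (hilbert_form K) k = nsq (hilbert_form H) s) ->
  (forall f k, B (f, k) ->
    exists2 s, S (f, s) & nsq (hilbert_form K) k = nsq (hilbert_form H) s) ->
  (S = (graph U \; B)%relation <-> B = (adj (graph U) \; S)%relation).
Proof.
move=> fS fB SB BS; split=> E; apply/seteqP; split=> -[f y] fy.
- have [s Sfs ys] := BS _ _ fy; exists s => //=.
  have SUy : S (f, U y) by rewrite E; exists y.
  rewrite (fS _ _ _ Sfs SUy); apply: adj_graph_isometric.
  by rewrite ys (fS _ _ _ SUy Sfs).
- case: fy => /= s Sfs sy; have := Sfs; rewrite {1}E => -[k /= Bfk]; rewrite {1}/graph /= => sk.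
  have [s' Sfs' ks'] := BS _ _ Bfk.
  rewrite -(fS _ _ _ Sfs Sfs') sk in ks'.
  have := adj_graph_isometric (esym ks'); rewrite -sk => /adj_graph_fun.
  by move=> /(_ _ sy) <-.
- have [k Bfk ky] := SB _ _ fy; exists k => //=.
  have := Bfk; rewrite {1}E => -[s /= Sfs sk].
  rewrite -(fS _ _ _ fy Sfs) in sk.
  rewrite /graph /= (adj_graph_inv sk ky) //.
- case: fy => /= k Bfk; rewrite {1}/graph /= => ky; have := Bfk; rewrite {1}E => -[s /= Sfs sk].
  have [s' Sfs' ks'] := BS _ _ Bfk.
  rewrite -(fS _ _ _ Sfs Sfs') in ks'.
  by rewrite ky (adj_graph_inv sk ks').
Qed.

End Structure.
End PartialIsometry.

(** * The regular part and the polar decomposition *)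

Section RegularPart.
Context {R : realType}.
Implicit Types H K : hilbertType R.

Lemma orthproj_mul_adj H K (X : set (H * K)) : linear_subspace X -> forall k,
  Defs.mul (adj X) (orthproj (Defs.mul (adj X)) k) /\
  perp (Defs.mul (adj X)) (k - orthproj (Defs.mul (adj X)) k).
Proof.
by move=> sX k; rewrite mul_adj; apply: orthproj_perp; exact: dom_subspace.
Qed.

(** The domain of the adjoint is orthogonal to the multivalued part of the
    closure. *)
Lemma mul_adj_perp H K (T : set (H * K)) k g :
  adj T (k, g) -> perp (Defs.mul (adj (adj T))) k.
Proof.
by move=> Tk n Nn; have := Nn _ Tk; rewrite /= inner0l => /inner_eq0C.
Qed.

(** The adjoint of [reg T] consists of the [(g, g')] for which the component of
    [g] orthogonal to the multivalued part N is mapped to [g'] by [adj T].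
    Taking [(n, 0)] with [n] in N shows that values are orthogonal to N; the pairs
    of [adj T] itself, whose first component is already orthogonal to N, show
    membership in the closure. *)
Lemma adjadj_reg H K (T : set (H * K)) : adj (adj (reg T)) =
  [set p | adj (adj T) p /\ perp (Defs.mul (adj (adj T))) p.2].
Proof.
set N := Defs.mul _.
have Np k := orthproj_mul_adj (adj_subspace T) k; rewrite -/N in Np.
have sN : linear_subspace N by rewrite /N mul_adj; exact: perp_subspace.
have Esym g k : inner K g (k - orthproj N k) = inner K (g - orthproj N g) k.
  have [Nk Mk] := Np k; have [Ng Mg] := Np g.
  rewrite -{1}(subrK (orthproj N g) g) innerDl (inner_eq0C (Mk _ Ng)) addr0.
  by rewrite innerBr (Mg _ Nk) subr0.
have regP x y : reg T (x, y) -> exists2 k', T (x, k') & y = k' - orthproj N k'.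
  by [].
apply/seteqP; split=> -[f k] /=.
  move=> regfk; split.
    move=> [g g'] Tg /=; apply: (regfk (g, g')).
    move=> [x y] /regP [k' Tk' ->]; rewrite /= (Tg _ Tk') /= Esym.
    have [Ng Mg] := Np g; have Pg : perp N g by exact: mul_adj_perp Tg.
    suff -> : orthproj N g = 0 by rewrite subr0.
    apply: inner_eq0; rewrite -{1}(subKr g (orthproj N g)).
    by rewrite innerBl (Pg _ Ng) (Mg _ Ng) subrr.
  move=> n Nn; have := regfk (n, 0).
  rewrite /= inner0r; apply.
  move=> [x y] /regP [k' Tk' ->]; rewrite /= inner0l Esym.
  have [Nn' Mn] := Np n.
  suff -> : n - orthproj N n = 0 by rewrite inner0l.
  apply: inner_eq0; rewrite {1}innerBr.
  by rewrite (Mn _ Nn) (Mn _ Nn') subrr.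
move=> [TTfk Pk] [g g'] /= Tg.
have [Ng Mg] := Np g.
have Tg' : adj T (g - orthproj N g, g').
  move=> [x y] Txy /=; rewrite -Esym.
  by apply: (Tg (x, _)); exists y.
have := TTfk _ Tg'; rewrite /= innerBr (Pk _ Ng) subr0.
by [].
Qed.

Section Core.
Variables (H K : hilbertType R) (T : set (H * K)) (res : H -> H).
Hypothesis HR : forall h, gram T (res h, h - res h).
Hypothesis symR : sym res.

(** [k] is the value at [res h] of the closed regular part; stating it as a
    relation keeps linearity in [h] free of a choice of [k]. *)
Definition solves (h : H) (k : K) :=
  adj (adj T) (res h, k) /\ adj T (k, h - res h).

Lemma solvesP h : exists k, solves h k.
Proof. by have [k] := HR h; exists k. Qed.

Lemma solves_lin a h u k l : solves h k -> solves u l ->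
  solves (a *: h + u) (a *: k + l).
Proof.
move=> [h1 h2] [u1 u2]; split.
  by rewrite sym_linear //; exact: ((adj_subspace (adj T)).2 a _ _ h1 u1).
rewrite sym_linear //.
have -> : a *: h + u - (a *: res h + res u) = a *: (h - res h) + (u - res u).
  by rewrite scalerBr opprD addrACA.
exact: ((adj_subspace T).2 a _ _ h2 u2).
Qed.

Lemma solves0 : solves 0 0.
Proof.
have R0 : res 0 = 0 by exact: sym0.
by split; rewrite R0 ?subr0; [case: (adj_subspace (adj T)) | case: (adj_subspace T)].
Qed.

Lemma solves_inner h k f l : solves h k -> adj (adj T) (f, l) ->
  inner K k l = inner H (h - res h) f.
Proof. by move=> [h1 h2] Tfl; rewrite (gram_inner h1 h2 Tfl). Qed.

(** The difference [d] of a pair of the regular part and its projection on the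
    candidate core satisfies [(d.1, J h) + (d.2, D h) = (d.1, h)] for all [h], so
    [d.1 = 0], and then [d.2] is both in the multivalued part and orthogonal to
    it. *)
Lemma regular_part_core f k : adj (adj (reg T)) (f, k) ->
  adh (graph_form H K) [set p | exists2 h, p.1 = res h & solves h p.2] (f, k).
Proof.
set L := (X in adh _ X) => Bfk.
have sL : linear_subspace L.
  split; first by exists 0; [rewrite sym0 | exact: solves0].
  move=> a [u1 u2] [v1 v2] [h /= -> hu] [l /= -> lv]; exists (a *: h + l) => /=.
    by rewrite sym_linear.
  exact: solves_lin.
have LB : L `<=` adj (adj (reg T)).
  move=> [p1 p2] [h /= -> [h1 h2]]; rewrite adjadj_reg; split=> //=.
  exact: mul_adj_perp h2.
have [p Lp zp] := projection (graph_form H K) (f, k) sL.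
have Bp : adj (adj (reg T)) p.
  by apply: adh_adj => e /(Lp e) [u Lu pu]; exists u => //; exact: LB.
have := subspaceB (adj_subspace _) Bfk Bp.
rewrite adjadj_reg => -[]; set d := (f, k) - p => TTd Pd.
have d1 : d.1 = 0.
  apply: inner_inj => h; rewrite inner0l.
  have [l hl] := solvesP h.
  have := zp (res h, l) (ex_intro2 _ _ h erefl hl).
  rewrite /= /pair_inner /= -/d.
  have : inner K d.2 l = inner H d.1 (h - res h).
    rewrite innerC (solves_inner hl (f := d.1)); last by case: (d) TTd.
    by rewrite -innerC.
  by move=> ->; rewrite innerBr addrC subrK.
have d2 : d.2 = 0.
  apply: inner_eq0; apply: Pd.
  by rewrite /Defs.mul /= -d1 -surjective_pairing.
suff -> : (f, k) = p by [].
apply/eqP; rewrite -subr_eq0 -/d; apply/eqP.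
by rewrite [d]surjective_pairing d1 d2.
Qed.

End Core.

Section Polar.
Variables (H K : hilbertType R) (T : set (H * K)) (res P Q : H -> H).
Notation A := (gram T).
Notation B := (adj (adj (reg T))).
Notation S := (rootrel A P Q).
Notation rp := (rip (hilbert_form H)).
Hypothesis HR : forall h, A (res h, h - res h).
Hypothesis (sP : sym P) (pP : pos P) (sQ : sym Q) (pQ : pos Q).
Hypothesis PP : forall x, P (P x) = res x.
Hypothesis QQ : forall x, Q (Q x) = x - res x.
Hypothesis PQ : forall x, P (Q x) = Q (P x).

Let saA : adj A = A := gram_sa T.
Let nnA : nonneg A := @gram_nonneg _ _ _ T.
Let symR : sym res := res_sym saA HR.

(** The isometric relation [D h |-> P Q h] from which the partial isometry is
    built. *)
Definition intertwiner : set (H * K) :=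
  [set p | exists2 h, p.1 = P (Q h) & solves T res h p.2].

Lemma intertwiner_subspace : linear_subspace intertwiner.
Proof.
split; first by exists 0; [rewrite (sym0 sQ) (sym0 sP) | exact: solves0].
move=> a [u1 u2] [v1 v2] [h /= -> hu] [l /= -> lv]; exists (a *: h + l) => /=.
  by rewrite (sym_linear _ _ _ sQ) (sym_linear _ _ _ sP).
exact: solves_lin.
Qed.

(** Both inner products equal [(h, J u - J J u)]. *)
Lemma intertwiner_isometric : isometric intertwiner.
Proof.
move=> [s k] [t l] [h /= -> hk] [u /= -> ul].
rewrite (solves_inner hk ul.1) sP sQ PP.
have -> : Q (res (Q u)) = res u - res (res u).
  by rewrite -[res (Q u)]PP PQ PQ PP QQ.
by rewrite innerBr innerBl symR.
Qed.

Lemma rootrel_closed p : adh (graph_form H H) S p -> S p.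
Proof.
move=> Sp; have [-> _] := rootrel_sa saA nnA HR sP sQ pQ PP QQ PQ.
have [ES SM] := rootrel_sa saA nnA HR sP sQ pQ PP QQ PQ.
split.
  by apply: adh_adj => e /(Sp e) [u Su pu]; exists u => //; move: Su; rewrite {1}ES => -[].
split; apply: adh_perpP => e /(Sp e) [u /SM[Mu1 Mu2]]; rewrite nsqP => pu.
  exists u.1 => //; apply: le_lt_trans pu; by rewrite lerDl nsq_ge0.
exists u.2 => //; apply: le_lt_trans pu; by rewrite lerDr nsq_ge0.
Qed.

Lemma rootrel_range h : S (res h, P (Q h)).
Proof.
exists (P h); last by rewrite /= PP PQ.
exact: (P_M saA nnA HR sP PP).
Qed.

(** If [(P x, Q x)] is orthogonal to all [(P P h, Q P h)] then [(P x, h) = 0] for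
    all [h], since [P^2 + Q^2 = 1]; so [x] is in the kernel of the resolvent and in
    its orthogonal complement. *)
Lemma rootrel_core f s : S (f, s) ->
  adh (graph_form H H) [set p | exists h, p = (res h, P (Q h))] (f, s).
Proof.
set L := (X in adh _ X) => Sfs.
have sL : linear_subspace L.
  split; first by exists 0; rewrite (sym0 sQ) (sym0 sP) (sym0 symR).
  move=> a _ _ [h ->] [l ->]; exists (a *: h + l).
  by rewrite (sym_linear _ _ _ symR) (sym_linear _ _ _ sQ) (sym_linear _ _ _ sP).
have LS : L `<=` S by move=> _ [h ->]; exact: rootrel_range.
have [p Lp zp] := projection (graph_form H H) (f, s) sL.
have Sp : S p.
  by apply: rootrel_closed => e /(Lp e) [u Lu pu]; exists u => //; exact: LS.
have [x Mx px] : exists2 x, perp (Defs.mul A) x & (f, s) - p = (P x, Q x).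
  case: Sfs => x Mx [-> ->]; case: Sp => y My ->; exists (x - y).
    exact: M_sub.
  by rewrite (symB _ _ sP) (symB _ _ sQ).
suff x0 : x = 0.
  suff -> : (f, s) = p by [].
  apply/eqP; rewrite -subr_eq0 px x0; apply/eqP.
  by rewrite (sym0 sQ) (sym0 sP).
have Px : P x = 0.
  apply: inner_inj => h; rewrite inner0l.
  have := zp (res h, P (Q h)) (ex_intro _ h erefl).
  rewrite px /= /pair_inner /= -symR -sP -sQ.
  have -> : Q (P (Q x)) = P x - P (res x) by rewrite -PQ QQ (symB _ _ sP).
  have -> : res (P x) = P (res x) by rewrite -!PP.
  by rewrite innerBl addrC subrK.
apply: (N_M_eq0 saA) => //; apply/(ker_res saA nnA HR).
by rewrite -PP Px (sym0 sP).
Qed.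

(** [U] is bounded and maps the core of one operator into the graph of the
    other, which is closed. *)
Lemma core_transfer (U : {linear K -> H}) f k :
  (forall k, nsq (hilbert_form H) (U k) <= nsq (hilbert_form K) k) ->
  (forall p, intertwiner p -> U p.2 = p.1) -> B (f, k) -> S (f, U k).
Proof.
move=> cU HU Bfk; apply: rootrel_closed => e e0.
have [[x l] [h /= -> hl] close] := regular_part_core HR symR Bfk e0.
exists (res h, P (Q h)); first exact: rootrel_range.
have UE : U l = P (Q h) := HU (P (Q h), l) (ex_intro2 _ _ h erefl hl).
rewrite -UE; apply: le_lt_trans close; rewrite !nsqP /= lerD2l -raddfB; exact: cU.
Qed.

Lemma core_transferV (V : {linear H -> K}) f s :
  (forall x, nsq (hilbert_form K) (V x) <= nsq (hilbert_form H) x) ->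
  (forall p, intertwiner p -> V p.1 = p.2) -> S (f, s) -> B (f, V s).
Proof.
move=> cV HV Sfs; apply: adh_adj => e e0.
have [_ [h ->] close] := rootrel_core Sfs e0.
have [l hl] := solvesP HR h.
exists (res h, l).
  rewrite adjadj_reg; split=> /=; first exact: hl.1.
  exact: mul_adj_perp hl.2.
have VE : V (P (Q h)) = l := HV (P (Q h), l) (ex_intro2 _ _ h erefl hl).
rewrite -VE; apply: le_lt_trans close; rewrite !nsqP /= lerD2l -raddfB; exact: cV.
Qed.

Lemma rootrel_fun f s s' : S (f, s) -> S (f, s') -> s = s'.
Proof.
move=> [x Mx [-> ->]] [y My [Pxy ->]].
suff : x - y = 0 by move=> /eqP; rewrite subr_eq0 => /eqP ->.
apply: (N_M_eq0 saA); last exact: M_sub.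
by apply/(ker_res saA nnA HR); rewrite -PP (symB _ _ sP) Pxy subrr (sym0 sP).
Qed.

Lemma adjadj_reg_fun f k k' : B (f, k) -> B (f, k') -> k = k'.
Proof.
move=> Bk Bk'; have := subspaceB (adj_subspace _) Bk Bk'.
rewrite /GRing.add /= /add_pair /= subrr adjadj_reg => -[/= Nk Mk].
by apply/eqP; rewrite -subr_eq0; apply/eqP; apply: inner_eq0; exact: Mk.
Qed.

(** The contractions built from the intertwiner and from its inverse transfer
    the two operators into each other.  Both being single-valued, the transfers
    are mutually inverse and preserve norms. *)
Lemma polar : exists U : {linear K -> H}, [/\ partial_isometry U,
    S = (graph U \; B)%relation,
    forall f s, S (f, s) ->
      exists2 k, B (f, k) & nsq (hilbert_form K) k = nsq (hilbert_form H) s &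
    forall f k, B (f, k) ->
      exists2 s, S (f, s) & nsq (hilbert_form K) k = nsq (hilbert_form H) s].
Proof.
have [U [piU cU HU]] := isometric_extension intertwiner_subspace intertwiner_isometric.
have [||V [_ cV HV]] := @isometric_extension _ _ _ [set q : K * H | intertwiner (q.2, q.1)].
- have [j0 jj] := intertwiner_subspace; split=> // a [u1 u2] [v1 v2] ju jv.
  exact: (jj a (u2, u1) (v2, v1)).
- move=> [k s] [l t] js jt.
  by have := intertwiner_isometric js jt => /= ->.
have BS f k : B (f, k) -> S (f, U k) by exact: core_transfer.
have SB f s : S (f, s) -> B (f, V s).
  by apply: core_transferV => // -[x y] jxy; exact: (HV (y, x)).
have UV f s : S (f, s) -> U (V s) = s.
  by move=> Sfs; apply: (rootrel_fun (BS _ _ (SB _ _ Sfs)) Sfs).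
have VU f k : B (f, k) -> V (U k) = k.
  by move=> Bfk; apply: (adjadj_reg_fun (SB _ _ (BS _ _ Bfk)) Bfk).
exists U; split=> //.
- apply/seteqP; split=> -[f s] /=.
    by move=> Sfs; exists (V s); [exact: SB | rewrite /graph /= (UV _ _ Sfs)].
  by move=> [k Bfk]; rewrite /graph /= => ->; exact: BS.
- move=> f s Sfs; exists (V s); first exact: SB.
  by apply/eqP; rewrite eq_le cV /= -{1}(UV _ _ Sfs) cU.
- move=> f k Bfk; exists (U k); first exact: BS.
  by apply/eqP; rewrite eq_le cU andbT -{1}(VU _ _ Bfk) cV.
Qed.

End Polar.

(** * Singular relations *)

Lemma closed_perp H (D : set H) : closed (perp D).
Proof.
rewrite closure_id adh_closureE; apply/seteqP; split; first exact: adhS.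
by move=> x; exact: adh_perpP.
Qed.

Lemma closed_perpE H (A : set H) : linear_subspace A -> closed A ->
  perp (perp A) = A.
Proof. by move=> sA /closure_id {2}->; rewrite closure_perp. Qed.

(** If the closure of [T] is [A `*` D], then [gram T] is [A `*` perp A].
    Conversely, if [gram T] is [A `*` D], each [f] in [A] has [(f, 0)] in the closure
    of [T], and the domain of the closure is contained in [A] because its
    complement [perp A] is the multivalued part of [gram T]. *)
Lemma singular_gram H K (T : set (H * K)) :
  singular T <-> singular (gram T).
Proof.
split=> -[A [D [sA cA sD cD E]]].
- exists A, (perp A); split=> //; [exact: perp_subspace | exact: closed_perp |].
  rewrite !gram_sa; apply/seteqP; split=> -[f g] /=.
    move=> [h Tfh Tg]; have Afh : (A `*` D) (f, h) by rewrite -E.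
    have [Af Dh] := Afh; split=> // x Ax /=.
    have Tx : adj (adj T) (x, 0) by rewrite E; split=> //; case: sD.
    by have := gram_inner Tfh Tg Tx; rewrite inner0r.
  move=> [Af /= Ag]; exists 0; first by rewrite /= E; split=> //; case: sD.
  rewrite -adjadjadj => -[x y]; rewrite E => -[/= Ax _].
  by rewrite inner0l Ag.
- have [A0 _] := sA; have [D0 _] := sD.
  rewrite !gram_sa in E.
  have TA f : A f -> adj (adj T) (f, 0).
    move=> Af; have : gram T (f, 0) by rewrite E.
    move=> [h Tfh Th]; suff h0 : h = 0 by rewrite -h0.
    by apply: inner_eq0; rewrite -(gram_inner Tfh Th Tfh) inner0l.
  have domA f k : adj (adj T) (f, k) -> A f.
    move=> Tfk; rewrite -(closed_perpE sA cA) => y Ay.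
    have : gram T (0, y).
      rewrite -gram_sa => -[x z]; rewrite E => -[/= Ax _].
      by rewrite inner0l Ay.
    move=> [h T0h Thy].
    have h0 : h = 0.
      by apply: inner_eq0; rewrite -(gram_inner T0h Thy T0h) inner0r.
    by apply: inner_eq0C; rewrite (gram_inner T0h Thy Tfk) h0 inner0l.
  exists A, (Defs.mul (adj (adj T))); split=> //.
  + by rewrite mul_adj; exact: perp_subspace.
  + by rewrite mul_adj; exact: closed_perp.
  + apply/seteqP; split=> -[f k] /=.
      move=> Tfk; have Af := domA _ _ Tfk; split=> //=.
      have := subspaceB (adj_subspace _) Tfk (TA _ Af).
      by rewrite /GRing.add /= /add_pair /= subrr subr0.
    move=> [/= Af Nk]; have := subspaceD (adj_subspace _) (TA _ Af) Nk.
    by rewrite /GRing.add /= /add_pair /= addr0 add0r.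
Qed.

End RegularPart.

(** * The limit relation and the limit operator *)

Theorem theorem10p4 (R : realType) (H K : hilbertType R)
    (KK : nat -> hilbertType R) (Tn : forall n, set (H * KK n))
    (T : set (H * K)) (Kinf : set (H * H))
    (Tn_op : forall n, linear_operator (Tn n))
    (Tn_closed : forall n, closed_relation (Tn n))
    (Tn_dom : forall m n, (m <= n)%N -> contractively_dominated (Tn n) (Tn m))
    (T_op : linear_operator T)
    (T_domain : T.`1 = \bigcup_n (Tn n).`1)
    (T_dom : forall n, contractively_dominated T (Tn n))
    (T_lim : norm_decreasing_to Tn T)
    (Kinf_sa : nonneg_selfadjoint Kinf)
    (Kinf_lim :
       let Kn n := (adj (Tn n) \; Tn n)%relation in
       strong_resolvent_limit Kn Kinf \/ strong_graph_limit Kn Kinf) :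
  [/\ Kinf = (adj T \; adj (adj T))%relation,
      forall U : {linear K -> H}, partial_isometry U ->
        (sqrt_reg Kinf = (graph U \; adj (adj (reg T)))%relation <->
         adj (adj (reg T)) = (adj (graph U) \; sqrt_reg Kinf)%relation),
      exists U : {linear K -> H},
        [/\ partial_isometry U,
            sqrt_reg Kinf = (graph U \; adj (adj (reg T)))%relation,
            adj (adj (reg T)) = (adj (graph U) \; sqrt_reg Kinf)%relation,
            closable T <-> T `<=` (adj (graph U) \; sqrt_reg Kinf)%relation &
            closed_relation T <->
              T = (adj (graph U) \; sqrt_reg Kinf)%relation] &
      singular T <-> singular Kinf].
Proof.
have KE := limit_gram Tn_op Tn_closed Tn_dom T_op T_domain T_dom T_lim
  Kinf_sa Kinf_lim.
have {KE Kinf_sa Kinf_lim}KE : Kinf = gram T := KE.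
subst Kinf.
have saA := gram_sa T; have nnA := @gram_nonneg _ _ _ T.
have /choice [res HR] h : exists f, gram T (f, h - f).
  by have [f [k [? ?]]] := gram_range T h; exists f, k.
have [P [Q [[sP pP sQ pQ] PP QQ [PQ pPQ] comm]]] :=
  root_pair (res_sym saA HR) (res_pos nnA HR) (res_le nnA HR).
rewrite (sqrt_regE saA nnA HR sP sQ pQ PP QQ PQ pPQ comm).
have fS f s s' := @rootrel_fun _ _ _ T res P Q HR sP PP f s s'.
have fB := @adjadj_reg_fun _ _ _ T.
have [U [piU SUB SB BS]] := polar HR sP sQ pQ PP QQ PQ.
have equiv V piV := @partial_isometry_factor _ H K V piV _ _ fS fB SB BS.
have BUS := (equiv U piU).1 SUB.
split=> //; last exact: singular_gram.
exists U; split=> //; rewrite -BUS adjadj_reg.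
- split=> [clT f Tf|TB].
    split; first exact: sub_adjadj.
    by rewrite clT => _ ->; rewrite inner0r.
  apply/seteqP; split=> [n Nn|_ ->]; last first.
    by rewrite mul_adj; case: (perp_subspace (adj T).`1).
  have : adj (adj (reg T)) (0, n).
    rewrite -adjadjadj; apply: (adjS (adjS _)) Nn.
    by rewrite adjadj_reg.
  by rewrite adjadj_reg => -[_ Pn]; apply: inner_eq0; exact: Pn.
- split=> [clT|TB].
    rewrite clT; have [_ ->] := T_op.
    apply/seteqP; split=> [f Tf|f [Tf _]] //.
    by split=> // _ ->; rewrite inner0r.
  by rewrite -adjadj_reg in TB; rewrite /closed_relation TB adjadjadj.
Qed.
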